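(* For every $m\in\mathbb{N}$, every $\gamma$ with $0<\gamma<1/\sqrt{m}$, and every $0<\eta<\xi<1$, there exists $P^*\in\mathbb{N}$ such that for every fixed integer $p\ge P^*$, as $n\to\infty$, \[ \mathbb{P}\bigl[\mathcal{S}_{\mathrm{p-spin}}(\gamma,m,\xi,\eta)\neq\varnothing\bigr]\ge 1-e^{-\Theta(n)} . \]
   Context: Let $\Sigma_n=\{-1,1\}^n$ and $\langle\sigma,\sigma'\rangle=\sum_{i\le n}\sigma(i)\sigma'(i)$. For an integer $p\ge 2$, let $\boldsymbol{J}=(J_{i_1,\dots,i_p}:1\le i_1,\dots,i_p\le n)$ have i.i.d. $\mathcal{N}(0,1)$ entries. The Ising $p$-spin Hamiltonian is \[ H(\sigma)=H_{n,p}(\sigma)=n^{-\frac{p+1}{2}}\sum_{1\le i_1,\dots,i_p\le n}J_{i_1,\dots,i_p}\,\sigma(i_1)\cdots\sigma(i_p),\qquad \sigma\in\Sigma_n . \] $\mathcal{S}_{\mathrm{p-spin}}(\gamma,m,\xi,\eta)$ is the (random) set of all $m$-tuples $(\sigma^{(1)},\dots,\sigma^{(m)})\in\Sigma_n^m$ such that (i) $H(\sigma^{(t)})\ge\gamma\sqrt{2\ln 2}$ for all $1\le t\le m$, and (ii) $n^{-1}\langle\sigma^{(t)},\sigma^{(\ell)}\rangle\in[\xi-\eta,\xi]$ for all $1\le t<\ell\le m$. The bound $\ge 1-e^{-\Theta(n)}$ means: there is a constant $c>0$, not depending on $n$ (it may depend on $m,\gamma,\xi,\eta,p$), such that the probability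 is at least $1-e^{-cn}$ for all sufficiently large $n$. *)

(* Defs.v *)
From HB Require Import structures.
From mathcomp Require Import all_boot all_order all_algebra.
From mathcomp Require Import all_classical all_reals all_analysis.

Set Implicit Arguments.
Unset Strict Implicit.
Unset Printing Implicit Defensive.

Import Order.TTheory GRing.Theory Num.Theory.
Import numFieldNormedType.Exports.

Local Open Scope classical_set_scope.
Local Open Scope ring_scope.

(* {-1,1}^n, encoded by booleans: [true] stands for +1, [false] for -1;
   the real coordinates are recovered by [spin]. *)
Definition Sigma (n : nat) := {ffun 'I_n -> bool}.

Definition spin (R : realType) (n : nat) (s : Sigma n) (i : 'I_n) : R :=
  if s i then 1 else -1.

Definition inner (R : realType) (n : nat) (s s' : Sigma n) : R :=
  \sum_(i < n) spin R s i * spin R s' i.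

(* (i_1, ..., i_p) ranges over all p-tuples of indices, repetitions allowed. *)
Definition multi_index (n p : nat) := {ffun 'I_p -> 'I_n}.

Definition hamiltonian (R : realType) (n p : nat) (g : multi_index n p -> R)
    (s : Sigma n) : R :=
  n%:R `^ (- (p.+1%:R / 2)) *
  \sum_(I : multi_index n p) g I * \prod_(k < p) spin R s (I k).

Definition S_pspin (R : realType) (n p : nat) (g : multi_index n p -> R)
    (gamma : R) (m : nat) (xi eta : R) : set (m.-tuple (Sigma n)) :=
  [set s | (forall t : 'I_m,
              gamma * Num.sqrt (2 * ln 2) <= hamiltonian g (tnth s t)) /\
           (forall t l : 'I_m, (t < l)%N ->
              xi - eta <= n%:R^-1 * inner R (tnth s t) (tnth s l) <= xi)].
Arguments S_pspin {R n p} g gamma m xi eta _.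

Definition mutually_independent (R : realType) (d : measure_display)
    (T : measurableType d) (P : probability T R) (I : finType)
    (X : I -> {RV P >-> R}) : Prop :=
  forall (A : {set I}) (B : I -> set R), (forall i, measurable (B i)) ->
    P (\bigcap_(i in [set` A]) (X i @^-1` B i)) =
    (\prod_(i in A) P (X i @^-1` B i))%E.

(* In [normal_prob 0 1] the parameters are the mean and the standard
   deviation. *)
Definition iid_standard_normal (R : realType) (d : measure_display)
    (T : measurableType d) (P : probability T R) (I : finType)
    (X : I -> {RV P >-> R}) : Prop :=
  mutually_independent X /\
  forall (i : I) (B : set R), measurable B ->
    distribution P (X i) B = normal_prob (0 : R) 1 B.

(* Main.v *)
(* Fix configurations u_1, ..., u_m with equal pairwise overlaps in
   [xi - eta, xi] and look only at the tuples (v u_1, ..., v u_m) with v in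
   Sigma_n, which have the same overlaps. Let beta lie strictly between
   gamma sqrt(2 ln 2) and sqrt(2 ln 2 / m), and let Z be the sum over v of
   exp(n beta sum_t H(v u_t)), restricted to the event that every H(v u_t) is
   within eps of beta. All moments of Z are controlled by the Gaussian Laplace
   transform. For p large, the overlaps bounded away from 1 in absolute value
   contribute a factor exp(delta n) with delta small; a pair (v, w) with an
   overlap near +1 or -1 contributes at most exp(n (m beta^2 / 2 + small)) and
   such pairs are a fraction 2^(-n (1 - small)) of all pairs, which is
   affordable as m beta^2 < 2 ln 2. By Paley-Zygmund, Z > 0 with probability at
   least exp(-2 delta n).

   This is boosted to 1 - exp(-c n) by a bounded-difference argument: changing
   one coordinate of J by h changes every H by at most n^(-(p+1)/2) |h|, and the
   squares of these n^p constants add up to 1/n. If F > 0 and log F is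
   c_i-Lipschitz in the i-th coordinate, then E[F(J)] E[1/F(J)] is at most
   exp(sum_i c_i^2): in one dimension this follows by symmetrisation and the
   bound cosh(log F(x) - log F(y)) <= cosh(c (x - y)), and it tensorizes by
   averaging one coordinate at a time. Applied to an exponential of the max-min
   of H, it gives P(max-min >= a) P(max-min < b) <= m exp(-n (a - b)^2 / 4). *)
Require Import Defs.
From HB Require Import structures.
From mathcomp Require Import all_boot all_order all_algebra.
From mathcomp Require Import all_classical all_reals all_analysis.
From mathcomp Require Import measurable_realfun.
From mathcomp Require Import ring lra zify.

Set Implicit Arguments.
Unset Strict Implicit.
Unset Printing Implicit Defensive.

Import Order.TTheory GRing.Theory Num.Theory.
Import numFieldNormedType.Exports.

Local Open Scope classical_set_scope.
Local Open Scope ring_scope.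

(** * Laplace transform of the standard normal law *)

(** The Radon-Nikodym derivative with respect to Lebesgue measure and the Gaussian density have
    equal integrals over all measurable sets, hence agree almost everywhere. *)
Lemma ge0_integral_normal_prob (R : realType) (f : R -> \bar R) :
  measurable_fun [set: R] f -> (forall x, 0 <= f x)%E ->
  (\int[normal_prob 0 1]_x f x =
   \int[lebesgue_measure]_x (f x * (normal_pdf 0 1 x)%:E))%E.
Proof.
move=> mf f0.
have dom : normal_prob (0 : R) 1 `<< lebesgue_measure.
  exact: normal_prob_dominates.
rewrite -(Radon_Nikodym_SigmaFinite.change_of_variables dom)//.
set g := Radon_Nikodym_SigmaFinite.f _ _.
have mg : measurable_fun [set: R] g.
  exact: measurable_int (Radon_Nikodym_SigmaFinite.f_integrable dom).
have mpdf : measurable_fun [set: R] (EFin \o normal_pdf (0 : R) 1).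
  by apply/measurable_EFinP; exact: measurable_normal_pdf.
apply: ae_eq_integral => //.
- exact: emeasurable_funM.
- exact: emeasurable_funM.
- have : ae_eq lebesgue_measure [set: R] g (EFin \o normal_pdf (0 : R) 1).
    apply: integral_ae_eq => //.
    + exact: (Radon_Nikodym_SigmaFinite.f_integrable dom).
    + by move=> A _ mA; rewrite -Radon_Nikodym_SigmaFinite.f_integral.
  by apply: filterS => x /= gx _; rewrite gx.
Qed.

Lemma normal_mgf (R : realType) (a : R) :
  (\int[normal_prob 0 1]_y (expR (a * y))%:E = (expR (a ^+ 2 / 2))%:E)%E.
Proof.
rewrite ge0_integral_normal_prob; last 2 first.
- by apply/measurable_EFinP; apply: measurableT_comp.
- by move=> x; rewrite lee_fin expR_ge0.
(* Completing the square turns the tilted density into a multiple of the density with mean [a]. *)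
transitivity (\int[lebesgue_measure]_y
    ((expR (a ^+ 2 / 2))%:E * (normal_pdf a 1 y)%:E))%E; last first.
  rewrite ge0_integralZl_EFin//.
  - by rewrite integral_normal_pdf mule1.
  - by move=> x _; rewrite lee_fin normal_pdf_ge0.
  - by apply/measurable_EFinP; exact: measurable_normal_pdf.
apply: eq_integral => y _; rewrite -!EFinM; congr EFin.
rewrite !normal_pdfE ?oner_neq0// /normal_fun.
rewrite mulrCA [RHS]mulrCA -!expRD; congr (_ * expR _).
by field.
Qed.

(** * Resampling one coordinate of an independent family *)

Section independent_tuple.
Context (R : realType) (d : measure_display) (T : measurableType d).
Context (P : probability T R) (N : nat) (X : 'I_N -> {RV P >-> R}).
Context (gam : probability R R).
Hypothesis X_indep : mutually_independent X.
Hypothesis X_law : forall i (B : set R), measurable B ->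
  P (X i @^-1` B) = gam B.

Definition joint (w : T) : N.-tuple R := [tuple X i w | i < N].

Definition upd (x : N.-tuple R) (i : 'I_N) (y : R) : N.-tuple R :=
  [tuple if j == i then y else tnth x j | j < N].

Lemma tnth_upd x i y j : tnth (upd x i y) j = if j == i then y else tnth x j.
Proof. by rewrite tnth_mktuple. Qed.

Lemma upd_upd x i y z : upd (upd x i y) i z = upd x i z.
Proof.
by apply: eq_from_tnth => j; rewrite !tnth_upd; case: (j == i).
Qed.

Lemma updC x i j y z : i != j -> upd (upd x i y) j z = upd (upd x j z) i y.
Proof.
move=> ij; apply: eq_from_tnth => k; rewrite !tnth_upd.
by have [->|//] := eqVneq k j; rewrite eq_sym (negbTE ij).
Qed.

Lemma measurable_joint : measurable_fun [set: T] joint.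
Proof.
apply/measurable_fun_tnthP => i.
rewrite (_ : _ \o _ = X i); first exact: measurable_funPT.
by apply/funext => w /=; rewrite tnth_mktuple.
Qed.

Lemma measurable_upd i :
  measurable_fun [set: N.-tuple R * R] (fun xy => upd xy.1 i xy.2).
Proof.
apply/measurable_fun_tnthP => j /=.
have [->|ji] := eqVneq j i.
  rewrite (_ : _ \o _ = snd); first exact: measurable_snd.
  by apply/funext => xy /=; rewrite tnth_upd eqxx.
rewrite (_ : _ \o _ = (fun x => tnth x j) \o fst).
  by apply: measurableT_comp => //; exact: measurable_tnth.
by apply/funext => xy /=; rewrite tnth_upd (negbTE ji).
Qed.

Definition box (B : 'I_N -> set R) : set (N.-tuple R) :=
  [set x | forall j, B j (tnth x j)].

Let boxes : set (set (N.-tuple R)) :=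
  [set box B | B in [set B | forall j, measurable (B j)]].

Lemma box_bigcap B :
  box B = \bigcap_(j in [set: 'I_N]) ((fun x => tnth x j) @^-1` B j).
Proof.
by apply/seteqP; split => x /= h j => [_|]; [exact: h|exact: (h j)].
Qed.

Lemma measurable_box B : (forall j, measurable (B j)) -> measurable (box B).
Proof.
move=> mB; rewrite box_bigcap.
apply: fin_bigcap_measurable => // j _.
by rewrite -[X in measurable X]setTI; exact: measurable_tnth.
Qed.

(** With [setI_closed_boxes], boxes form a generating pi-system, so a probability law on tuples is
    determined by its values on them. *)
Lemma measurable_tuple_boxes : @measurable _ (N.-tuple R) = <<s boxes >>.
Proof.
apply/seteqP; split.
  apply: smallest_sub; first exact: smallest_sigma_algebra.
  rewrite -bigcup_seq => A [i _ [B mB <-]].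
  apply: sub_sigma_algebra; exists (fun j => if j == i then B else setT).
    by move=> j /=; case: ifP.
  apply/seteqP; split => x /=.
    by move=> /(_ i); rewrite eqxx.
  by move=> [_ Bx] j; case: eqP => // ->.
apply: smallest_sub; first exact: sigma_algebra_measurable.
by move=> _ [B mB <-]; exact: measurable_box.
Qed.

Lemma setI_closed_boxes : setI_closed boxes.
Proof.
move=> _ _ [B mB <-] [C mC <-]; exists (fun j => B j `&` C j).
  by move=> j; exact: measurableI.
apply/seteqP; split => x /=; first by move=> h; split=> j; have [] := h j.
by move=> [h1 h2] j; split; [exact: h1|exact: h2].
Qed.

Lemma prob_joint_box B : (forall j, measurable (B j)) ->
  P (joint @^-1` box B) = (\prod_j gam (B j))%E.
Proof.
move=> mB.
rewrite (_ : _ @^-1` _ = \bigcap_(i in [set` [set: 'I_N]%SET]) (X i @^-1` B i)).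
  rewrite X_indep//; apply: eq_big => [i|i _]; first by rewrite inE.
  exact: X_law.
apply/seteqP; split => w /= h.
  by move=> i _; have := h i; rewrite tnth_mktuple.
by move=> i; rewrite tnth_mktuple; apply: h => /=; rewrite inE.
Qed.

(* The law of [joint] and its image under an independent resampling of the
   coordinate [i] agree on boxes. *)
Lemma integral_joint_upd (F : N.-tuple R -> \bar R) i :
  measurable_fun [set: N.-tuple R] F -> (forall x, 0 <= F x)%E ->
  (\int[P]_w F (joint w) = \int[P]_w \int[gam]_y F (upd (joint w) i y))%E.
Proof.
move=> mF F0.
pose Zm := isMeasurableFun.Build _ _ _ _ _ measurable_joint.
pose Z : {mfun T >-> N.-tuple R} := HB.pack joint Zm.
pose Um := isMeasurableFun.Build _ _ _ _ _ (measurable_upd i).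
pose U : {mfun (N.-tuple R * R)%type >-> N.-tuple R} :=
  HB.pack (fun xy => upd xy.1 i xy.2) Um.
pose mu := distribution P Z.
pose nu := distribution (mu \x gam)%E U.
have munu A : measurable A -> mu A = nu A.
  apply: (measure_unique boxes (fun=> setT)) => //.
  - exact: measurable_tuple_boxes.
  - exact: setI_closed_boxes.
  - by move=> _; exists (fun=> setT); [move=> j|apply/seteqP; split => x].
  - by apply/seteqP; split => // x _; exists 0%N.
  - move=> _ [B mB <-]; rewrite /mu /nu /distribution /pushforward/=.
    rewrite [LHS]prob_joint_box//.
    (* The preimage of a box under resampling is a rectangle: side [i] constrains only the fresh
       value, the other sides only the old tuple. *)
    pose C j := if j == i then setT else B j.
    have mC j : measurable (C j) by rewrite /C; case: ifP.
    rewrite (_ : _ @^-1` _ = box C `*` B i).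
      rewrite product_measure1E//; last exact: measurable_box.
      rewrite [X in (X * _)%E]prob_joint_box// (bigD1 i)//= [RHS]muleC.
      congr (_ * _)%E; rewrite [RHS](bigD1 i)//= {1}/C eqxx probability_setT.
      by rewrite mul1e; apply: eq_bigr => j ji; rewrite /C (negbTE ji).
    apply/seteqP; split => -[x y] /= h.
      split; last by have := h i; rewrite tnth_upd eqxx.
      by move=> j; have := h j; rewrite tnth_upd /C; case: ifP.
    move=> j; rewrite tnth_upd; case: eqP => [->|/eqP ji]; first exact: h.2.
    by have := h.1 j; rewrite /C (negbTE ji).
  - by move=> _; rewrite -ge0_fin_numE// fin_num_measure.
transitivity (\int[mu]_x F x)%E; first by rewrite ge0_integral_distribution.
transitivity (\int[nu]_x F x)%E.
  by apply: eq_measure_integral => A mA _; exact: munu.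
have mFU : measurable_fun [set: N.-tuple R * R] (F \o U).
  by apply: measurableT_comp => //; exact: measurable_upd.
rewrite ge0_integral_distribution// fubini_tonelli1//; last first.
  by move=> xy; exact: F0.
rewrite ge0_integral_distribution//.
- have FU0 xy : (0 <= (F \o U) xy)%E by exact: F0.
  refine (@measurable_fun_fubini_tonelli_F _ _ _ _ _ _ _ mFU FU0).
- by move=> x; apply: integral_ge0 => y _; exact: F0.
Qed.

End independent_tuple.

(** * Log-Lipschitz functions of a Gaussian vector *)

Section real_integral.
Context (R : realType) (d : measure_display) (T : measurableType d).
Context (mu : {measure set T -> \bar R}).
Implicit Types (k : R) (f g : T -> R).

Lemma ge0_le_integralr f g : (forall x, 0 <= f x) ->
  measurable_fun [set: T] f -> measurable_fun [set: T] g ->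
  (forall x, f x <= g x) ->
  (\int[mu]_x (f x)%:E <= \int[mu]_x (g x)%:E)%E.
Proof.
move=> f0 mf mg fg; apply: ge0_le_integral => //; do ?exact/measurable_EFinP.
- by move=> x _; rewrite lee_fin.
- by move=> x _; rewrite lee_fin.
Qed.

Lemma ge0_integralZlr k f : 0 <= k ->
  measurable_fun [set: T] f -> (forall x, 0 <= f x) ->
  (\int[mu]_x (k * f x)%:E = k%:E * \int[mu]_x (f x)%:E)%E.
Proof.
move=> k0 mf f0; rewrite -ge0_integralZl_EFin//; last exact/measurable_EFinP.
by move=> x _; rewrite lee_fin.
Qed.

Lemma ge0_integralDr f g :
  measurable_fun [set: T] f -> (forall x, 0 <= f x) ->
  measurable_fun [set: T] g -> (forall x, 0 <= g x) ->
  (\int[mu]_x (f x + g x)%:E =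
   \int[mu]_x (f x)%:E + \int[mu]_x (g x)%:E)%E.
Proof.
move=> mf f0 mg g0; rewrite -ge0_integralD//.
- by move=> x _; rewrite lee_fin.
- exact/measurable_EFinP.
- by move=> x _; rewrite lee_fin.
- exact/measurable_EFinP.
Qed.

Lemma ge0_integral_sumr (I : finType) (f : I -> T -> R) :
  (forall i, measurable_fun [set: T] (f i)) -> (forall i x, 0 <= f i x) ->
  (\int[mu]_x (\sum_i f i x)%:E = \sum_i \int[mu]_x (f i x)%:E)%E.
Proof.
move=> mf f0; rewrite -ge0_integral_sum//.
- by apply: eq_integral => x _; rewrite sumEFin.
- by move=> i; exact/measurable_EFinP.
- by move=> i x _; rewrite lee_fin.
Qed.

Lemma measurable_funV_gt0 f : measurable_fun [set: T] f ->
  (forall x, 0 < f x) -> measurable_fun [set: T] (fun x => (f x)^-1).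
Proof.
move=> mf f0.
rewrite (_ : (fun _ => _) = (fun x => expR (- ln (f x)))); last first.
  by apply/funext => x; rewrite expRN lnK// posrE.
by do 2 apply: measurableT_comp => //; apply: measurableT_comp.
Qed.

End real_integral.

Section exp_lipschitz.
Context (R : realType) (gam : probability R R).
Implicit Types (c : R) (f : R -> R).
Hypothesis gam_mgf : forall a : R,
  (\int[gam]_y (expR (a * y))%:E = (expR (a ^+ 2 / 2))%:E)%E.

(** For positive [f] this says that [ln f] is [c]-Lipschitz, in a form that passes to averages. *)
Definition exp_lip (c : R) (f : R -> R) :=
  forall x y, f y <= expR (c * `|y - x|) * f x.

Lemma exp_lipV c f : (forall x, 0 < f x) -> exp_lip c f ->
  exp_lip c (fun x => (f x)^-1).
Proof.
move=> f0 fc x y; rewrite ler_pdivlMr// ler_pdivrMl//.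
by rewrite mulrC distrC; exact: fc.
Qed.

Lemma measurable_expRM (a : R) :
  measurable_fun [set: R] (fun y : R => expR (a * y)).
Proof. by apply: measurableT_comp => //; exact: mulrl_measurable. Qed.

Lemma expR_norm_le (c x : R) :
  expR (c * `|x|) <= expR (c * x) + expR (- c * x).
Proof.
by case: (ger0P x) => _; rewrite ?mulrN ?mulNr ?lerDl ?lerDr expR_ge0.
Qed.

(** Comparison with the value at 0 dominates [f] by a multiple of two exponentials, whose integrals
    are known. *)
Lemma exp_lip_integral_fin c f : measurable_fun [set: R] f ->
  (forall x, 0 < f x) -> exp_lip c f ->
  exists2 I : R, 0 <= I & (\int[gam]_y (f y)%:E = I%:E)%E.
Proof.
move=> mf f0 fc.
have I0 : (0 <= \int[gam]_y (f y)%:E)%E.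
  by apply: integral_ge0 => y _; rewrite lee_fin ltW.
have Ifin : (\int[gam]_y (f y)%:E < +oo)%E.
  apply: (@le_lt_trans _ _ (\int[gam]_y (f 0 *
      (expR (c * y) + expR (- c * y)))%:E)%E).
    apply: ge0_le_integralr => //.
    - by move=> y; exact: ltW.
    - apply: measurable_funM => //.
      by apply: measurable_funD; exact: measurable_expRM.
    - move=> y; rewrite mulrC; apply: (le_trans (fc 0 y)).
      by rewrite subr0 ler_pM2r// expR_norm_le.
  have mE a : measurable_fun [set: R] (fun y : R => expR (a * y)).
    exact: measurable_expRM.
  have e0 a (y : R) : 0 <= expR (a * y) by exact: expR_ge0.
  rewrite (ge0_integralZlr _ (ltW (f0 0)) (measurable_funD (mE c) (mE (- c)))).
    rewrite (ge0_integralDr _ (mE c) (e0 c) (mE (- c)) (e0 (- c))).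
    by rewrite !gam_mgf -EFinD -EFinM ltry.
  by move=> y; rewrite addr_ge0.
exists (fine (\int[gam]_y (f y)%:E)); first exact: fine_ge0.
by rewrite fineK// ge0_fin_numE.
Qed.

Lemma exp_lip_integral_gt0 c f : measurable_fun [set: R] f ->
  (forall x, 0 < f x) -> exp_lip c f ->
  exists2 I : R, 0 < I & (\int[gam]_y (f y)%:E = I%:E)%E.
Proof.
move=> mf f0 fc; have [I I0 IE] := exp_lip_integral_fin mf f0 fc.
have mfV : measurable_fun [set: R] (fun x => (f x)^-1).
  exact: measurable_funV_gt0.
have fV0 x : 0 < (f x)^-1 by rewrite invr_gt0.
have [K K0 KE] := exp_lip_integral_fin mfV fV0 (exp_lipV f0 fc).
exists I => //.
(* This choice gives [t ^+ 2 * K <= t], so that the integrated inequality below yields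
   [I >= t > 0]. *)
pose t := (K + 1)^-1.
have t0 : 0 < t by rewrite invr_gt0 ltr_wpDl.
(* AM-GM: [2 t <= f + t^2 / f] *)
have : ((2 * t)%:E <= I%:E + (t ^+ 2)%:E * K%:E)%E.
  rewrite -IE -KE -ge0_integralZlr ?sqr_ge0//; last by move=> x; exact: ltW.
  rewrite -ge0_integralDr//.
  - rewrite -[leLHS]mule1 -(@probability_setT _ _ _ gam) -integral_cst//.
    apply: ge0_le_integralr => //.
    + by move=> y; rewrite mulr_ge0// ltW.
    + by apply: measurable_funD => //; exact: measurable_funM.
    + move=> y; rewrite -subr_ge0.
      rewrite (_ : _ - _ = (f y - t) ^+ 2 * (f y)^-1).
        by rewrite mulr_ge0 ?sqr_ge0// ltW.
      by field; rewrite gt_eqF.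
  - by move=> x; exact: ltW.
  - exact: measurable_funM.
  - by move=> x; rewrite mulr_ge0 ?sqr_ge0// ltW.
rewrite -EFinM -EFinD lee_fin => h.
have tK : t ^+ 2 * K <= t.
  rewrite expr2 -mulrA ger_pMr// /t mulrC ler_pdivrMr ?ltr_wpDl//.
  by rewrite mul1r lerDl.
lra.
Qed.

(** For independent [x] and [y], twice the product of the integrals of [f] and [1 / f] is the mean
    of f(x)/f(y) + f(y)/f(x). This is at most the mean of 2 cosh(c(x - y)), namely 2 exp(c^2). *)
Lemma exp_lip_integralV_le c f I : measurable_fun [set: R] f ->
  (forall x, 0 < f x) -> exp_lip c f ->
  0 < I -> (\int[gam]_y (f y)%:E = I%:E)%E ->
  (\int[gam]_y ((f y)^-1)%:E <= (expR (c ^+ 2) * I^-1)%:E)%E.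
Proof.
move=> mf f0 fc I0 IE.
have mfV : measurable_fun [set: R] (fun x => (f x)^-1).
  exact: measurable_funV_gt0.
have fV0 x : 0 < (f x)^-1 by rewrite invr_gt0.
have [K K0 KE] := exp_lip_integral_gt0 mfV fV0 (exp_lipV f0 fc).
rewrite KE lee_fin ler_pdivlMr//.
have f0' x : 0 <= f x by exact: ltW.
have fV0' x : 0 <= (f x)^-1 by exact: ltW.
have e0 x : 0 <= expR x :> R by exact: expR_ge0.
(* [cosh (ln (f x) - ln (f y)) <= cosh (c (x - y))] *)
have symm (x y : R) : f x * (f y)^-1 + (f x)^-1 * f y <=
    expR (c * x) * expR (- c * y) + expR (- c * x) * expR (c * y).
  (* [r] lies between [e^-1] and [e], and on that interval r + 1/r is largest at the endpoints. *)
  pose r := f x * (f y)^-1; pose e := expR (c * `|x - y|).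
  have r0 : 0 < r by rewrite /r mulr_gt0.
  have e_gt0 : 0 < e by exact: expR_gt0.
  have re : r <= e by rewrite /r ler_pdivrMr//; exact: fc.
  have er : 1 <= e * r.
    by rewrite /r mulrA ler_pdivlMr// mul1r /e distrC; exact: fc.
  have -> : (f x)^-1 * f y = r^-1 by rewrite /r invfM invrK mulrC.
  have -> : expR (c * x) * expR (- c * y) + expR (- c * x) * expR (c * y) =
      e + e^-1.
    rewrite -!expRD /e -expRN.
    have [_|_] := ger0P (x - y).
      by congr (expR _ + expR _); ring.
    by rewrite addrC; congr (expR _ + expR _); ring.
  rewrite -subr_ge0.
  have -> : e + e^-1 - (r + r^-1) = (e - r) * (e * r - 1) / (e * r).
    by field; rewrite !gt_eqF.
  by rewrite !mulr_ge0 ?subr_ge0// invr_ge0 mulr_ge0// ltW.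
have inner (x : R) : f x * K + (f x)^-1 * I <=
    expR (c * x) * expR (c ^+ 2 / 2) + expR (- c * x) * expR (c ^+ 2 / 2).
  have : (\int[gam]_y (f x * (f y)^-1 + (f x)^-1 * f y)%:E <=
    \int[gam]_y (expR (c * x) * expR (- c * y) +
                 expR (- c * x) * expR (c * y))%:E)%E.
    apply: ge0_le_integralr => //.
    - by move=> y; rewrite addr_ge0 ?mulr_ge0.
    - by apply: measurable_funD; exact: measurable_funM.
    - by apply: measurable_funD; apply: measurable_funM => //;
        exact: measurable_expRM.
  have mE a : measurable_fun [set: R] (fun y : R => expR (a * y)).
    exact: measurable_expRM.
  rewrite !ge0_integralDr;
    [|by [apply: measurable_funM|move=> y; rewrite mulr_ge0]..].
  rewrite !ge0_integralZlr// IE KE !gam_mgf sqrrN.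
  by rewrite -!EFinM -!EFinD lee_fin.
have : (\int[gam]_x (f x * K + (f x)^-1 * I)%:E <=
    \int[gam]_x (expR (c * x) * expR (c ^+ 2 / 2) +
                 expR (- c * x) * expR (c ^+ 2 / 2))%:E)%E.
  apply: ge0_le_integralr => //.
  - by move=> y; rewrite addr_ge0 ?mulr_ge0 ?(ltW I0) ?(ltW K0).
  - by apply: measurable_funD; exact: measurable_funM.
  - by apply: measurable_funD; apply: measurable_funM => //;
      exact: measurable_expRM.
have mE a : measurable_fun [set: R] (fun y : R => expR (a * y)).
  exact: measurable_expRM.
under eq_integral do rewrite [X in X + _]mulrC [X in _ + X]mulrC.
under [leRHS]eq_integral do rewrite [X in X + _]mulrC [X in _ + X]mulrC.
have I0' := ltW I0; have K0' := ltW K0.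
rewrite !ge0_integralDr;
  [|by [apply: measurable_funM|move=> y; rewrite mulr_ge0]..].
rewrite !ge0_integralZlr// IE KE !gam_mgf sqrrN.
rewrite -!EFinM -!EFinD lee_fin -expRD -splitr.
by rewrite (mulrC I); lra.
Qed.

End exp_lipschitz.

(** * Tensorization of the one-dimensional inequality *)

Section tensorization.
Context (R : realType) (d : measure_display) (T : measurableType d).
Context (P : probability T R) (N : nat) (X : 'I_N -> {RV P >-> R}).
Context (gam : probability R R).
Hypothesis X_indep : mutually_independent X.
Hypothesis X_law : forall i (B : set R), measurable B ->
  P (X i @^-1` B) = gam B.
Hypothesis gam_mgf : forall a : R,
  (\int[gam]_y (expR (a * y))%:E = (expR (a ^+ 2 / 2))%:E)%E.
Implicit Types (c : R) (F : N.-tuple R -> R).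

Definition coord_exp_lip c F := forall x i y,
  F (upd x i y) <= expR (c * `|y - tnth x i|) * F x.

(** Evaluated at the independent family, this is the conditional expectation given all coordinates
    but [i]. By [averageP] the integral is finite, so [fine] loses nothing. *)
Definition average i F (x : N.-tuple R) : R :=
  fine (\int[gam]_y (F (upd x i y))%:E).

Lemma measurable_section F i x : measurable_fun [set: N.-tuple R] F ->
  measurable_fun [set: R] (fun y => F (upd x i y)).
Proof.
move=> mF; apply: (measurableT_comp mF).
have mx : measurable_fun [set: R] (fun y : R => (x, y)).
  exact: measurable_fun_pair.
exact: (measurableT_comp (@measurable_upd R N i) mx).
Qed.

Lemma exp_lip_section c F i x : coord_exp_lip c F ->
  exp_lip c (fun y => F (upd x i y)).
Proof.
by move=> Fc y z; have := Fc (upd x i y) i z; rewrite upd_upd tnth_upd eqxx.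
Qed.

Section one_coordinate.
Variables (c : R) (F : N.-tuple R -> R) (i : 'I_N).
Hypothesis mF : measurable_fun [set: N.-tuple R] F.
Hypothesis F0 : forall x, 0 < F x.
Hypothesis Fc : coord_exp_lip c F.

Lemma averageP x :
  0 < average i F x /\
  (\int[gam]_y (F (upd x i y))%:E = (average i F x)%:E)%E.
Proof.
have [I I0 IE] := exp_lip_integral_gt0 gam_mgf
  (measurable_section i x mF) (fun y => F0 (upd x i y)) (exp_lip_section i x Fc).
by rewrite /average IE.
Qed.

Lemma measurable_average : measurable_fun [set: N.-tuple R] (average i F).
Proof.
have mG : measurable_fun [set: N.-tuple R * R]
    (fun xy => (F (upd xy.1 i xy.2))%:E).
  apply/measurable_EFinP; apply: measurableT_comp => //.
  exact: measurable_upd.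
have G0 (xy : N.-tuple R * R) : (0 <= (F (upd xy.1 i xy.2))%:E)%E.
  by rewrite lee_fin ltW.
have := @measurable_fun_fubini_tonelli_F _ _ _ _ _ gam _ mG G0.
exact: (measurableT_comp (@fine_measurable _ _ measurableT)).
Qed.

(** The average does not depend on coordinate [i]; in any other coordinate the bound passes under
    the integral, because updates of distinct coordinates commute. *)
Lemma coord_exp_lip_average : 0 <= c -> coord_exp_lip c (average i F).
Proof.
move=> c0 x j y.
have [->|ji] := eqVneq j i.
  rewrite [X in X <= _](_ : _ = average i F x); last first.
    by rewrite /average; under eq_integral do rewrite upd_upd.
  rewrite ler_peMl ?(ltW (averageP x).1)// -expR0 ler_expR.
  by rewrite mulr_ge0.
rewrite -lee_fin -(averageP _).2 EFinM -(averageP _).2 -ge0_integralZlr//.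
- apply: ge0_le_integralr.
  + by move=> z; rewrite ltW.
  + exact: measurable_section.
  + apply: measurable_funM => //; exact: measurable_section.
  + move=> z; rewrite updC//.
    have := Fc (upd x i z) j y.
    by rewrite tnth_upd (negbTE ji).
- exact: measurable_section.
- by move=> z; rewrite ltW.
Qed.

Lemma average_integral :
  (\int[P]_w (F (joint X w))%:E = \int[P]_w (average i F (joint X w))%:E)%E.
Proof.
rewrite (@integral_joint_upd _ _ _ _ _ _ _ X_indep X_law (EFin \o F) i) //.
- by apply: eq_integral => w _; rewrite (averageP _).2.
- exact/measurable_EFinP.
- by move=> x; rewrite lee_fin ltW.
Qed.

(** After resampling coordinate [i], the one-dimensional inequality applies to each section, at the
    cost of one factor exp(c^2). *)
Lemma average_integralV :
  (\int[P]_w ((F (joint X w))^-1)%:E <=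
   (expR (c ^+ 2))%:E * \int[P]_w ((average i F (joint X w))^-1)%:E)%E.
Proof.
have mj := measurable_joint X.
have mV : measurable_fun [set: N.-tuple R] (fun x => (F x)^-1).
  exact: measurable_funV_gt0.
have mA : measurable_fun [set: N.-tuple R] (fun x => (average i F x)^-1).
  apply: measurable_funV_gt0; first exact: measurable_average.
  by move=> x; exact: (averageP x).1.
rewrite (@integral_joint_upd _ _ _ _ _ _ _ X_indep X_law (fun x => ((F x)^-1)%:E) i).
- rewrite -ge0_integralZlr//.
  + have mFU : measurable_fun [set: N.-tuple R * R]
        (fun xy => ((F (upd xy.1 i xy.2))^-1)%:E).
      apply/measurable_EFinP.
      by apply: (measurableT_comp mV); exact: measurable_upd.
    have FU0 (xy : N.-tuple R * R) : (0 <= ((F (upd xy.1 i xy.2))^-1)%:E)%E.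
      by rewrite lee_fin invr_ge0 ltW.
    apply: ge0_le_integral => //.
    * by move=> w _; apply: integral_ge0 => y _; rewrite lee_fin invr_ge0 ltW.
    * have := @measurable_fun_fubini_tonelli_F _ _ _ _ _ gam _ mFU FU0.
      by move=> h; exact: (measurableT_comp h mj).
    * apply/measurable_EFinP; apply: measurable_funM => //.
      exact: (measurableT_comp mA mj).
    * move=> w _; have [A0 AE] := averageP (joint X w).
      apply: (exp_lip_integralV_le gam_mgf (measurable_section i _ mF) _
        (exp_lip_section i _ Fc) A0 AE) => y.
      exact: F0.
  + exact: (measurableT_comp mA mj).
  + by move=> w; rewrite invr_ge0 ltW// (averageP _).1.
- exact/measurable_EFinP.
- by move=> x; rewrite lee_fin invr_ge0 ltW.
Qed.

End one_coordinate.

(** Induction on a list [s] of coordinates that determine [F]. Averaging over the head leaves a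
    function of the tail, preserves the mean of [F], and costs one factor exp(c^2) in the mean of
    [1 / F]. *)
Lemma tensorization_seq (s : seq 'I_N) c F : 0 <= c ->
  measurable_fun [set: N.-tuple R] F -> (forall x, 0 < F x) ->
  coord_exp_lip c F ->
  (forall x x', {in s, forall j, tnth x j = tnth x' j} -> F x = F x') ->
  (\int[P]_w (F (joint X w))%:E * \int[P]_w ((F (joint X w))^-1)%:E <=
   (expR (c ^+ 2 *+ size s))%:E)%E.
Proof.
move=> c0; elim: s F => [|i s IHs] F mF F0 Fc dep.
  pose x0 : N.-tuple R := [tuple 0 | _ < N].
  have FE x : F x = F x0 by apply: dep => j; rewrite in_nil.
  rewrite (eq_integral (cst (F x0)%:E)); last by move=> w _; rewrite FE.
  rewrite [X in (_ * X)%E](eq_integral (cst ((F x0)^-1)%:E)); last first.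
    by move=> w _; rewrite FE.
  have Ecst k : (\int[P]_w (cst k%:E w) = k%:E)%E.
    transitivity (k%:E * P [set: T])%E; first exact: integral_cst.
    by rewrite probability_setT mule1.
  rewrite !Ecst -EFinM.
  by rewrite divff ?gt_eqF// mulr0n expR0.
rewrite (average_integral i mF F0 Fc).
have A0 x : 0 < average i F x by have [] := averageP i mF F0 Fc x.
have {}IHs := IHs (average i F) (measurable_average i mF F0) A0
  (coord_exp_lip_average i mF F0 Fc c0) _.
apply: (@le_trans _ _ (\int[P]_w (average i F (joint X w))%:E *
    ((expR (c ^+ 2))%:E * \int[P]_w ((average i F (joint X w))^-1)%:E))%E).
  apply: lee_wpmul2l; last exact: average_integralV.
  by apply: integral_ge0 => w _; rewrite lee_fin ltW.
rewrite muleCA /= mulrS expRD EFinM.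
apply: lee_wpmul2l; first by rewrite lee_fin expR_ge0.
apply: IHs => x x' xx'; rewrite /average.
apply: congr1; apply: eq_integral => y _; congr EFin.
apply: dep => j; rewrite inE !tnth_upd; case: eqP => //= _.
exact: xx'.
Qed.

Lemma tensorization c F : 0 <= c ->
  measurable_fun [set: N.-tuple R] F -> (forall x, 0 < F x) ->
  coord_exp_lip c F ->
  (\int[P]_w (F (joint X w))%:E * \int[P]_w ((F (joint X w))^-1)%:E <=
   (expR (c ^+ 2 *+ N))%:E)%E.
Proof.
move=> c0 mF F0 Fc; rewrite -[X in _ *+ X]size_enum_ord.
apply: tensorization_seq => // x x' xx'.
by congr F; apply: eq_from_tnth => j; apply: xx'; rewrite mem_enum.
Qed.

End tensorization.

(** * Laplace transform of linear forms in independent normals *)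

Section joint_mgf.
Context (R : realType) (d : measure_display) (T : measurableType d).
Context (P : probability T R) (N : nat) (X : 'I_N -> {RV P >-> R}).
Context (gam : probability R R).
Hypothesis X_indep : mutually_independent X.
Hypothesis X_law : forall i (B : set R), measurable B ->
  P (X i @^-1` B) = gam B.
Hypothesis gam_mgf : forall a : R,
  (\int[gam]_y (expR (a * y))%:E = (expR (a ^+ 2 / 2))%:E)%E.

Lemma measurable_linear (s : seq 'I_N) (a : 'I_N -> R) :
  measurable_fun [set: N.-tuple R] (fun x => \sum_(j <- s) a j * tnth x j).
Proof.
apply: measurable_sum => j; apply: measurable_funM => //.
exact: measurable_tnth.
Qed.

(** Resampling the head coordinate, which by uniqueness does not occur in the tail, splits off its
    one-dimensional Laplace transform. *)
Lemma joint_mgf_seq (s : seq 'I_N) (a : 'I_N -> R) : uniq s ->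
  (\int[P]_w (expR (\sum_(j <- s) a j * tnth (joint X w) j))%:E =
   (expR (\sum_(j <- s) a j ^+ 2 / 2))%:E)%E.
Proof.
elim: s => [_|i s IHs /= /andP[is_ us]].
  transitivity (\int[P]_w (cst 1%E w))%E.
    by apply: eq_integral => w _; rewrite big_nil expR0.
  transitivity (1 * P [set: T])%E; first exact: integral_cst.
  by rewrite probability_setT mule1 big_nil expR0.
pose F (x : N.-tuple R) := (expR (\sum_(j <- i :: s) a j * tnth x j))%:E.
have mE (s' : seq 'I_N) : measurable_fun [set: N.-tuple R]
    (fun x => expR (\sum_(j <- s') a j * tnth x j)).
  by apply: measurableT_comp => //; exact: measurable_linear.
rewrite -/F (@integral_joint_upd _ _ _ _ _ _ _ X_indep X_law F i); last 2 first.
- by apply/measurable_EFinP; exact: mE.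
- by move=> x; rewrite lee_fin expR_ge0.
rewrite big_cons expRD EFinM -IHs//.
rewrite -ge0_integralZlr ?expR_ge0//; last first.
  exact: (measurableT_comp (mE s) (measurable_joint X)).
apply: eq_integral => w _.
set x := joint X w.
transitivity (\int[gam]_y (expR (\sum_(j <- s) a j * tnth x j) *
    expR (a i * y))%:E)%E.
  apply: eq_integral => y _; rewrite /F big_cons tnth_upd eqxx addrC expRD.
  congr ((expR _ * _)%:E); apply: eq_big_seq => j js.
  by rewrite tnth_upd; case: eqP => // ji; rewrite -ji js in is_.
rewrite ge0_integralZlr ?expR_ge0//; last exact: measurable_expRM.
by rewrite gam_mgf -EFinM mulrC.
Qed.

End joint_mgf.

Section iid_normal.
Context (R : realType) (d : measure_display) (T : measurableType d).
Context (P : probability T R) (I : finType) (J : I -> {RV P >-> R}).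

(** Reindexing by ordinals makes the results on tuples applicable to the couplings. *)
Definition enum_family (k : 'I_#|I|) : {RV P >-> R} := J (enum_val k).

Lemma enum_family_independent :
  mutually_independent J -> mutually_independent enum_family.
Proof.
move=> Jind A B mB.
have := Jind (enum_val @: A)%SET (fun i => B (enum_rank i)) (fun i => mB _).
rewrite big_imset/=; last by move=> x y _ _; exact: enum_val_inj.
rewrite (_ : \bigcap_(i in [set` (enum_val @: A)%SET]) _ =
    \bigcap_(k in [set` A]) (enum_family k @^-1` B k)).
  by move=> ->; apply: eq_bigr => k _; rewrite enum_valK.
apply/seteqP; split => w /= h.
  move=> k kA; have := h (enum_val k); rewrite /= enum_valK; apply.
  exact: imset_f.
by move=> i /= /imsetP[k kA ->]; rewrite enum_valK; exact: h.
Qed.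

Lemma measurable_idR :
  measurable_fun [set: measurableTypeR R] (fun x : measurableTypeR R => x : R).
Proof. by move=> _ Y mY; rewrite setTI. Qed.

(** [normal_prob] lives on [measurableTypeR R]; its image under the identity is a probability on
    [R], as the resampling results require. *)
Lemma standard_normal_exists : exists gam : probability R R,
  (forall B : set R, measurable B -> gam B = normal_prob 0 1 B) /\
  (forall a : R,
    (\int[gam]_y (expR (a * y))%:E = (expR (a ^+ 2 / 2))%:E)%E).
Proof.
pose im := isMeasurableFun.Build _ _ _ _ _ measurable_idR.
pose i : {mfun measurableTypeR R >-> R} :=
  HB.pack (fun x : measurableTypeR R => x : R) im.
exists (distribution (normal_prob 0 1) i); split => [B mB|a].
  by rewrite /distribution /pushforward.
rewrite ge0_integral_distribution.
- exact: normal_mgf.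
- by apply/measurable_EFinP; exact: measurable_expRM.
- by move=> y; rewrite lee_fin expR_ge0.
Qed.

Hypothesis J_iid : iid_standard_normal J.

Lemma iid_normal_mgf (a : I -> R) :
  (\int[P]_w (expR (\sum_i a i * J i w))%:E =
   (expR ((\sum_i a i ^+ 2) / 2))%:E)%E.
Proof.
have [gam [gamE gam_mgf]] := standard_normal_exists.
have Xlaw k (B : set R) : measurable B -> P (enum_family k @^-1` B) = gam B.
  by move=> mB; rewrite gamE//; exact: J_iid.2.
have sumE (f : I -> R) :
    \sum_i f i = \sum_(k <- enum 'I_#|I|) f (enum_val k).
  rewrite big_enum/=; apply: reindex.
  exact/onW_bij/(@enum_val_bij I).
have := joint_mgf_seq (enum_family_independent J_iid.1) Xlaw gam_mgf
  (fun k => a (enum_val k)) (enum_uniq 'I_#|I|).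
rewrite -mulr_suml -(sumE (fun i => a i ^+ 2)) => <-.
apply: eq_integral => w _; rewrite sumE; congr ((expR _)%:E).
by apply: eq_bigr => k _; rewrite tnth_mktuple.
Qed.

Lemma iid_normal_tensorization (c : R) (F : #|I|.-tuple R -> R) : 0 <= c ->
  measurable_fun [set: #|I|.-tuple R] F -> (forall x, 0 < F x) ->
  coord_exp_lip c F ->
  (\int[P]_w (F (joint enum_family w))%:E *
   \int[P]_w ((F (joint enum_family w))^-1)%:E <=
   (expR (c ^+ 2 *+ #|I|))%:E)%E.
Proof.
have [gam [gamE gam_mgf]] := standard_normal_exists.
have Xlaw k (B : set R) : measurable B -> P (enum_family k @^-1` B) = gam B.
  by move=> mB; rewrite gamE//; exact: J_iid.2.
exact: (tensorization (enum_family_independent J_iid.1) Xlaw gam_mgf).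
Qed.

Lemma joint_enum_familyE w i : tnth (joint enum_family w) (enum_rank i) = J i w.
Proof. by rewrite tnth_mktuple /enum_family enum_rankK. Qed.

End iid_normal.

(** * The Hamiltonian as a Gaussian field *)

Section hamiltonian_algebra.
Context (R : realType) (n : nat).
Implicit Types (s u v w : Sigma n).

Definition overlap s s' : R := n%:R^-1 * inner R s s'.

Lemma spin_sqr s i : spin R s i * spin R s i = 1.
Proof. by rewrite /spin; case: ifP => _; rewrite ?mulrNN mulr1. Qed.

Lemma overlap_self s : (0 < n)%N -> overlap s s = 1.
Proof.
move=> n0; rewrite /overlap /inner; under eq_bigr do rewrite spin_sqr.
by rewrite sumr_const card_ord mulVf// pnatr_eq0 -lt0n.
Qed.

(** With [true] for +1, boolean equality is the product of signs. Acting by a common [v] preserves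
    all overlaps of a family. *)
Definition mulS v u : Sigma n := [ffun i => v i == u i].

Lemma spin_mulS v u i : spin R (mulS v u) i = spin R v i * spin R u i.
Proof.
by rewrite /spin ffunE; case: (v i); case: (u i); rewrite /= ?mulrNN ?mulr1 ?mul1r.
Qed.

Lemma overlap_mulS v u u' : overlap (mulS v u) (mulS v u') = overlap u u'.
Proof.
congr (_ * _); apply: eq_bigr => i _.
by rewrite !spin_mulS mulrACA spin_sqr mul1r.
Qed.

Section coefficients.
Variable p : nat.

Definition spin_coef s (I : multi_index n p) : R :=
  n%:R `^ (- (p.+1%:R / 2)) * \prod_(k < p) spin R s (I k).

Lemma hamiltonianE (g : multi_index n p -> R) s :
  hamiltonian g s = \sum_I spin_coef s I * g I.
Proof.
rewrite /hamiltonian mulr_sumr; apply: eq_bigr => I _.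
by rewrite /spin_coef -mulrA (mulrC (g I)).
Qed.

Lemma spin_coef_scale : (0 < n)%N ->
  (n%:R `^ (- (p.+1%:R / 2)) : R) ^+ 2 = n%:R^-1 * n%:R^-1 ^+ p.
Proof.
move=> n0; rewrite -powR_mulrn ?powR_ge0// -powRrM mulNr divfK ?pnatr_eq0//.
by rewrite powRN powR_mulrn// -exprS exprVn.
Qed.

Lemma norm_spin_coef s I :
  `|spin_coef s I| = n%:R `^ (- (p.+1%:R / 2)).
Proof.
rewrite normrM ger0_norm ?powR_ge0// normr_prod big1 ?mulr1// => k _.
by rewrite /spin; case: ifP => _; rewrite ?normrN normr1.
Qed.

(** The covariance of H(s) and H(s'): the sum over multi-indices factorises into the [p]-th power of
    a sum over sites. *)
Lemma sum_spin_coefM s s' : (0 < n)%N ->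
  \sum_I spin_coef s I * spin_coef s' I = n%:R^-1 * overlap s s' ^+ p.
Proof.
move=> n0; rewrite /spin_coef.
under eq_bigr do rewrite mulrACA -big_split/=.
rewrite -mulr_sumr -expr2 spin_coef_scale// -mulrA; congr (_ * _).
rewrite /overlap exprMn; congr (_ * _).
by rewrite /inner -[in RHS](card_ord p) -prodr_const bigA_distr_bigA.
Qed.

(** The variance of n sum_k b_k H(s_k), which determines its Laplace transform. *)
Lemma sum_spin_coef_sqr (K : finType) (b : K -> R) (s : K -> Sigma n) :
  (0 < n)%N ->
  \sum_I (\sum_k n%:R * b k * spin_coef (s k) I) ^+ 2 =
  n%:R * \sum_k \sum_l b k * b l * overlap (s k) (s l) ^+ p.
Proof.
move=> n0; under eq_bigr do rewrite expr2 big_distrlr/=.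
rewrite exchange_big/= mulr_sumr; apply: eq_bigr => k _.
rewrite exchange_big/= mulr_sumr; apply: eq_bigr => l _.
under eq_bigr do rewrite mulrACA.
rewrite -mulr_sumr sum_spin_coefM//.
by field; rewrite pnatr_eq0 -lt0n.
Qed.

End coefficients.

(** The sum factorises over sites, and the signs disappear because cosh is even. *)
Lemma sum_expR_spin (c : 'I_n -> bool) (a : R) :
  \sum_w expR (a * \sum_i (-1) ^+ c i * spin R w i) =
  (expR a + expR (- a)) ^+ n.
Proof.
rewrite -[in RHS](card_ord n) -prodr_const.
transitivity (\prod_(i < n) \sum_(b : bool)
    expR (a * ((-1) ^+ c i * (if b then 1 else -1)))).
  rewrite bigA_distr_bigA/=; apply: eq_bigr => w _.
  by rewrite mulr_sumr expR_sum.
apply: eq_bigr => i _; rewrite big_bool/=.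
by case: (c i);
  rewrite /= ?expr1 ?expr0 ?mulr1 ?mulrNN ?mulr1 ?mul1r ?mulrN ?mulr1// addrC.
Qed.

(** Chernoff bound for a sum of independent signs; the factor 2 accounts for the two tails. *)
Lemma card_large_overlap v u u' (a rho : R) : 0 < a -> (0 < n)%N ->
  #|[set w | rho <= `|overlap (mulS v u) (mulS w u')|]%SET|%:R <=
  2 * ((expR a + expR (- a)) * expR (- (a * rho))) ^+ n.
Proof.
(* [(-1) ^+ c i] is the product of the three fixed signs at site [i]. *)
move=> a0 n0; pose c i := (v i == u i) != u' i.
have ovE w : overlap (mulS v u) (mulS w u') =
    n%:R^-1 * \sum_i (-1) ^+ c i * spin R w i.
  congr (_ * _); apply: eq_bigr => i _.
  rewrite !spin_mulS /c /spin.
  by case: (v i); case: (u i); case: (u' i); case: (w i) => /=;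
    rewrite ?expr1 ?expr0; ring.
have n0' : 0 < n%:R :> R by rewrite ltr0n.
pose S w := \sum_i (-1) ^+ c i * spin R w i.
rewrite -sum1_card natr_sum /=.
apply: (@le_trans _ _ (\sum_w (expR (a * S w) + expR (- a * S w)) *
    expR (- (a * rho)) ^+ n)).
  rewrite big_mkcond/=; apply: ler_sum => w _.
  rewrite inE ovE -/(S w); case: ifP => [h|_]; last first.
    by rewrite mulr_ge0 ?exprn_ge0 ?addr_ge0 ?expR_ge0.
  have {h}: rho * n%:R <= `|S w|.
    by move: h; rewrite normrM gtr0_norm ?invr_gt0// ler_pdivlMl// mulrC.
  move=> h; apply: (@le_trans _ _ (expR (a * `|S w|) * expR (- (a * rho)) ^+ n)).
    rewrite -expRM_natl -expRD -[leLHS]expR0 ler_expR.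
    have := ler_wpM2l (ltW a0) h. lra.
  rewrite ler_wpM2r ?exprn_ge0 ?expR_ge0//; exact: expR_norm_le.
rewrite -mulr_suml big_split/= !sum_expR_spin opprK.
by rewrite (addrC (expR (- a)) (expR a)) exprMn -mulr2n mulr_natl mulrnAl.
Qed.

End hamiltonian_algebra.

(** Off-diagonal terms are at most e |b_k| |b_l|, and adding the diagonal completes the square. Used
    with [e] equal to [rho ^+ p], it makes weakly overlapping energies almost independent for large
    [p]. *)
Lemma quadratic_form_le (R : realType) (K : finType) (b : K -> R)
    (r : K -> K -> R) (e : R) : 0 <= e ->
  (forall k, r k k = 1) -> (forall k l, k != l -> `|r k l| <= e) ->
  \sum_k \sum_l b k * b l * r k l <=
  \sum_k b k ^+ 2 + e * (\sum_k `|b k|) ^+ 2.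
Proof.
move=> e0 r1 re.
rewrite expr2 big_distrlr/= mulr_sumr -big_split/=; apply: ler_sum => k _.
rewrite (bigD1 k)//= r1 mulr1 -expr2 lerD2l.
rewrite mulr_sumr [leRHS](bigD1 k)//=.
rewrite -[leLHS]add0r lerD ?mulr_ge0//; apply: ler_sum => l lk.
apply: (le_trans (ler_norm _)); rewrite !normrM mulrC.
by rewrite ler_wpM2r ?mulr_ge0// re// eq_sym.
Qed.

(** The product equals exp(a(1 - rho)) (1 + exp(-2a)), which is close to 1 once [a] is large and a(1
    - rho) is small. Few configurations then overlap strongly with a given one. *)
Lemma chernoff_parameters (R : realType) (xi theta : R) : 0 < theta -> xi < 1 ->
  exists a rho : R, [/\ 0 < a, xi <= rho, rho < 1 &
    (expR a + expR (- a)) * expR (- (a * rho)) <= expR theta].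
Proof.
move=> t0 xi1; pose a := theta^-1.
(* [a = 1 / theta] gives exp(-2a) <= 1/(2a) = theta/2, and [rho] is close enough to 1 that a(1 -
   rho) <= theta/2. The maximum with [xi] lets [rho] also bound the overlaps inside a tuple. *)
have a0 : 0 < a by rewrite invr_gt0.
pose rho := Num.max xi (1 - theta / (2 * a)).
exists a, rho; split => //.
- by rewrite le_max lexx.
- by rewrite gt_max xi1 ltrBlDr ltrDl divr_gt0// mulr_gt0.
have h1 : a * (1 - rho) <= theta / 2.
  have : 1 - theta / (2 * a) <= rho by rewrite le_max lexx orbT.
  move=> /(ler_wpM2l (ltW a0)); have -> : a * (1 - theta / (2 * a)) = a - theta / 2.
    by field; rewrite gt_eqF.
  lra.
have h2 : expR (- (2 * a)) <= theta / 2.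
  rewrite expRN; apply: (@le_trans _ _ (2 * a)^-1).
    rewrite lef_pV2 ?posrE ?expR_gt0 ?mulr_gt0//.
    by apply: (le_trans _ (expR_ge1Dx _)); rewrite lerDr.
  by rewrite invfM /a invrK mulrC.
have -> : (expR a + expR (- a)) * expR (- (a * rho)) =
    expR (a * (1 - rho)) * (1 + expR (- (2 * a))).
  rewrite mulrDl mulrDr mulr1 -!expRD.
  by congr (expR _ + expR _); ring.
rewrite [X in _ <= expR X](splitr theta) expRD ler_pM ?expR_ge0 ?addr_ge0 ?expR_ge0//.
  by rewrite ler_expR.
by apply: (le_trans _ (expR_ge1Dx _)); rewrite lerD2l.
Qed.

(** * Configurations with equal prescribed overlaps *)

Lemma sum_nat_shift (V : nmodType) (g : nat -> V) (a b : nat) :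
  \sum_(a <= j < a + b) g j = \sum_(0 <= j < b) g (j + a)%N.
Proof. by rewrite -{1}[a]add0n big_addn addKn. Qed.

(** In each block of length 2h the two halves cancel. *)
Lemma antiperiodic_sum0 (R : realType) (g : nat -> R) (h K : nat) :
  (forall j, g (j + h)%N = - g j) -> \sum_(0 <= j < (h + h) * K) g j = 0.
Proof.
move=> gh; elim: K => [|K IHK]; first by rewrite muln0 big_geq.
rewrite mulnS addnC (@big_cat_nat _ _ _ ((h + h) * K)%N)//= ?leq_addr//.
rewrite IHK add0r sum_nat_shift (@big_cat_nat _ _ _ h)//= ?leq_addr//.
rewrite [X in _ + X]sum_nat_shift -big_split/= big1// => i _.
by rewrite addnAC gh subrr.
Qed.

(** This parity is the binary digit of weight [2 ^ t]: adding [2 ^ t] flips it, while a higher power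
    of two leaves it unchanged. *)
Lemma odd_div_pow_add t j : odd ((j + 2 ^ t) %/ 2 ^ t) = ~~ odd (j %/ 2 ^ t).
Proof. by rewrite divnDr ?dvdnn// divnn expn_gt0/= addn1. Qed.

Lemma odd_div_pow_addl t l j : (t < l)%N ->
  odd ((j + 2 ^ l) %/ 2 ^ t) = odd (j %/ 2 ^ t).
Proof.
move=> tl; rewrite -(subnK (ltnW tl)) expnD divnDr ?dvdn_mull//.
rewrite mulnK ?expn_gt0// oddD oddX /= orbF.
by rewrite subn_eq0 leqNgt tl addbF.
Qed.

(* The first [n - 2^m B] coordinates are constant and the remaining ones carry
   the binary digits of their position, which are pairwise orthogonal; hence
   all overlaps equal [1 - 2^m B / n]. *)
Lemma equal_overlap_family (R : realType) (m : nat) (xi eta : R) :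
  0 < eta -> eta < xi -> xi < 1 ->
  exists N : nat, forall n : nat, (N <= n)%N ->
  exists u : 'I_m -> Sigma n, forall t l, t != l ->
    0 <= overlap R (u t) (u l) /\ xi - eta <= overlap R (u t) (u l) <= xi.
Proof.
move=> eta0 etaxi xi1; have xi0 : 0 < xi by exact: lt_trans etaxi.
pose M := (2 ^ m)%N.
pose N0 := Num.truncn ((M%:R + 1) / eta : R).
exists N0.+1 => n Nn.
have etan : M%:R + 1 <= eta * n%:R.
  rewrite mulrC -ler_pdivrMr//; apply/ltW.
  apply: (lt_le_trans (truncnS_gt _)); first by rewrite ler_nat.
have n0 : 0 < n%:R :> R by rewrite ltr0n; exact: leq_trans Nn.
pose a0 := Num.truncn (xi * n%:R).
have /andP[a0le a0gt] : a0%:R <= xi * n%:R < a0.+1%:R.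
  by apply: truncn_itv; rewrite mulr_ge0// ltW.
have a0n : (a0 <= n)%N.
  by rewrite -(ler_nat R); nra.
have Ma0 : (M <= a0)%N.
  rewrite -ltnS -(ltr_nat R); apply: le_lt_trans a0gt.
  by nra.
have M0 : (0 < M)%N by rewrite expn_gt0.
(* Rounding [n - a0] up to a multiple of [M] puts [A] between [a0 - M] and [a0]; since
   [M + 1 <= eta * n], the overlap A/n stays in the required interval. *)
pose B := ((n - a0) %/ M).+1.
have MB1 : (n - a0 < M * B)%N by rewrite mulnC ltn_ceil.
have MB2 : (M * B <= n - a0 + M)%N.
  by rewrite mulnS addnC leq_add2r mulnC leq_trunc_div.
have MBn : (M * B <= n)%N by lia.
pose A := (n - M * B)%N.
have nE : n = (A + M * B)%N by rewrite /A subnK.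
pose f t j := if (j < A)%N then true else ~~ odd ((j - A) %/ 2 ^ t).
exists (fun t : 'I_m => [ffun i : 'I_n => f (val t) (val i)]) => t l tl.
have key t' l' : (t' < l')%N -> (l' < m)%N ->
  \sum_(i < n) (if f t' i then 1 else -1) * (if f l' i then 1 else -1) = A%:R :> R.
  move=> tl' lm.
  rewrite -(big_mkord xpredT (fun i => (if f t' i then 1 else -1 : R) *
    (if f l' i then 1 else -1))).
  rewrite nE (@big_cat_nat _ _ _ A)//= ?leq_addr//.
  rewrite [X in _ + X]sum_nat_shift.
  pose g j : R := (if ~~ odd (j %/ 2 ^ t') then 1 else -1) *
           (if ~~ odd (j %/ 2 ^ l') then 1 else -1).
  rewrite [X in _ + X](eq_bigr g); last first.
    by move=> i _; rewrite /g /f ltnNge leq_addl/= addnK.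
  (* The product of digits t' < l' changes sign under a shift by [2 ^ l']. As l' < m, the last
     [M * B] positions consist of whole periods. *)
  have -> : (M * B)%N = ((2 ^ l' + 2 ^ l') * (2 ^ (m - l'.+1) * B))%N.
    by rewrite addnn -muln2 -expnSr mulnA -expnD subnKC.
  rewrite antiperiodic_sum0 ?addr0.
    rewrite (eq_big_nat _ _ (F2 := fun=> 1)); last first.
      by move=> i /= iA; rewrite /f iA mulr1.
    by rewrite big_const_nat subn0 iter_addr addr0.
  move=> j; rewrite /g odd_div_pow_add odd_div_pow_addl//.
  by case: (odd (j %/ 2 ^ l')); rewrite /= ?mulr1 ?mulrN1 ?opprK.
have ovE : overlap R [ffun i : 'I_n => f (val t) (val i)]
    [ffun i : 'I_n => f (val l) (val i)] = n%:R^-1 * A%:R.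
  congr (_ * _); rewrite /inner /spin.
  under eq_bigr do rewrite !ffunE.
  have [tl'|lt'|/val_inj tl'] := ltngtP (val t) (val l).
  - exact: key (ltn_ord l).
  - by under eq_bigr do rewrite mulrC; exact: key (ltn_ord t).
  - by rewrite tl' eqxx in tl.
rewrite ovE; split; first by rewrite mulr_ge0// invr_ge0 ltW.
have A1 : (A <= a0)%N by lia.
have A2 : (a0 <= A + M)%N by lia.
move: A1 A2; rewrite -!(ler_nat R) natrD => A1 A2.
rewrite mulrC ler_pdivlMr// ler_pdivrMr//; apply/andP; split; last by lra.
by rewrite -natr1 in a0gt; lra.
Qed.

(** * Concentration *)

Lemma measurable_bigmaxr (R : realType) (d : measure_display)
    (T : measurableType d) (I : Type) (s : seq I) (f : I -> T -> R) :
  (forall i, measurable_fun [set: T] (f i)) ->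
  measurable_fun [set: T] (fun x => \big[Order.max/0]_(i <- s) f i x).
Proof.
move=> mf; elim: s => [|i s IHs].
  by under eq_fun do rewrite big_nil; exact: measurable_cst.
by under eq_fun do rewrite big_cons; exact: measurable_maxr.
Qed.

(** Markov's inequality. *)
Lemma measure_le_integral (R : realType) (d : measure_display)
    (T : measurableType d) (mu : {measure set T -> \bar R}) (A : set T)
    (k : R) (f : T -> R) : 0 <= k -> measurable A ->
  measurable_fun [set: T] f -> (forall x, 0 <= f x) ->
  (forall x, A x -> k <= f x) -> (k%:E * mu A <= \int[mu]_x (f x)%:E)%E.
Proof.
move=> k0 mA mf f0 kf.
rewrite -[X in mu X]setIT -(integral_indic mu measurableT mA) -ge0_integralZlr//.
  apply: ge0_le_integralr => //.
  - by move=> x; rewrite mulr_ge0.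
  - exact: measurable_funM.
  - move=> x; rewrite indicE; case: (boolP (x \in A)) => [/set_mem xA|_].
      by rewrite mulr1; exact: kf.
    by rewrite mulr0.
Qed.

Section pspin.
Context (R : realType) (n p m : nat) (u : 'I_m -> Sigma n).
Context (d : measure_display) (T : measurableType d) (P : probability T R).
Context (J : multi_index n p -> {RV P >-> R}).
Hypothesis J_iid : iid_standard_normal J.
Hypothesis n_gt0 : (0 < n)%N.
Hypothesis m_gt0 : (0 < m)%N.

Definition energy (s : Sigma n) (w : T) : R :=
  hamiltonian (fun I => J I w) s.

Lemma measurable_energy s : measurable_fun [set: T] (energy s).
Proof.
rewrite /energy; under eq_fun do rewrite hamiltonianE.
by apply: measurable_sum => I; apply: measurable_funM.
Qed.

Lemma energy_mgf (K : finType) (b : K -> R) (s : K -> Sigma n) :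
  (\int[P]_w (expR (n%:R * \sum_k b k * energy (s k) w))%:E =
   (expR (n%:R / 2 *
      \sum_k \sum_l b k * b l * overlap R (s k) (s l) ^+ p))%:E)%E.
Proof.
rewrite mulrAC -sum_spin_coef_sqr// -(iid_normal_mgf J_iid).
apply: eq_integral => w _; congr ((expR _)%:E).
under [RHS]eq_bigr do rewrite mulr_suml.
rewrite exchange_big/= mulr_sumr; apply: eq_bigr => k _.
rewrite /energy hamiltonianE !mulr_sumr; apply: eq_bigr => I _.
by rewrite !mulrA.
Qed.

Definition reached (a : R) : set T :=
  [set w | exists v, forall t, a <= energy (mulS v (u t)) w].

Lemma measurable_energy_ge s a : measurable [set w | a <= energy s w].
Proof.
rewrite -[X in measurable X]setTI.
rewrite (_ : [set _ | _] = energy s @^-1` `[a, +oo[); last first.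
  by apply/seteqP; split => w /=; rewrite in_itv/= andbT.
exact: measurable_energy.
Qed.

Lemma measurable_reached a : measurable (reached a).
Proof.
rewrite (_ : reached a = \bigcup_(v in [set: Sigma n])
    \bigcap_(t in [set: 'I_m]) [set w | a <= energy (mulS v (u t)) w]).
  apply: fin_bigcup_measurable; first exact: finite_finset.
  move=> v _; apply: fin_bigcap_measurable; first exact: finite_finset.
  by move=> t _; exact: measurable_energy_ge.
apply/seteqP; split => w /=.
  by move=> [v vP]; exists v => // t _; exact: vP.
by move=> [v _ vP]; exists v => t; exact: vP.
Qed.

Section concentration.
Variable lambda : R.
Hypothesis lambda_ge0 : 0 <= lambda.

(* Within a factor [m] of [expR (lambda * min_t H (v u_t))]. *)
Definition soft_min (g : multi_index n p -> R) (v : Sigma n) : R :=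
  (\sum_t expR (- lambda * hamiltonian g (mulS v (u t))))^-1.

(** The default value 0 is harmless, as every [soft_min] is positive. *)
Definition soft_maxmin (x : #|{: multi_index n p}|.-tuple R) : R :=
  \big[Order.max/0]_v soft_min (fun I => tnth x (enum_rank I)) v.

Lemma soft_sum_gt0 (g : multi_index n p -> R) v :
  0 < \sum_t expR (- lambda * hamiltonian g (mulS v (u t))) :> R.
Proof.
by rewrite (bigD1 (Ordinal m_gt0))//= ltr_pwDl ?expR_gt0// sumr_ge0.
Qed.

Lemma soft_maxmin_gt0 x : 0 < soft_maxmin x.
Proof.
apply: lt_le_trans (le_bigmax _ _ [ffun=> true]).
by rewrite invr_gt0 soft_sum_gt0.
Qed.

Lemma measurable_soft_maxmin :
  measurable_fun [set: #|{: multi_index n p}|.-tuple R] soft_maxmin.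
Proof.
apply: measurable_bigmaxr => v; apply: measurable_funV_gt0; last first.
  by move=> x; exact: soft_sum_gt0.
apply: measurable_sum => t; apply: measurableT_comp => //.
apply: measurable_funM => //.
under eq_fun do rewrite hamiltonianE.
apply: measurable_sum => I; apply: measurable_funM => //.
exact: measurable_tnth.
Qed.

Let kappa : R := n%:R `^ (- (p.+1%:R / 2)).

(** Changing one coupling by h moves every energy by at most [kappa] |h|. Each exponential changes
    by at most the corresponding factor, and so do the inverse of their sum and the maximum. *)
Lemma coord_exp_lip_soft_maxmin :
  coord_exp_lip (lambda * kappa) soft_maxmin.
Proof.
move=> x i y; set e := expR _.
have e0 : 0 < e by exact: expR_gt0.
apply: bigmax_le => [|v _]; first by rewrite mulr_ge0 ?ltW// soft_maxmin_gt0.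
apply: (@le_trans _ _ (e * soft_min (fun I => tnth x (enum_rank I)) v)); last first.
  by rewrite ler_pM2l//; exact: le_bigmax.
rewrite /soft_min -[e]invrK -invfM lef_pV2 ?posrE ?mulr_gt0 ?invr_gt0 ?soft_sum_gt0//.
rewrite mulr_sumr; apply: ler_sum => t _.
rewrite -expRN -expRD ler_expR !hamiltonianE.
set s := mulS v (u t).
have -> : \sum_I spin_coef R s I * tnth (upd x i y) (enum_rank I) =
    \sum_I spin_coef R s I * tnth x (enum_rank I) +
    spin_coef R s (enum_val i) * (y - tnth x i).
  rewrite (bigD1 (enum_val i))//= [X in _ = X + _](bigD1 (enum_val i))//=.
  rewrite tnth_upd !enum_valK eqxx.
  rewrite [X in _ + X = _](eq_bigr
    (fun I => spin_coef R s I * tnth x (enum_rank I))); first by ring.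
  move=> I Ii; rewrite tnth_upd; case: eqP => // Iri.
  by rewrite -Iri enum_rankK eqxx in Ii.
have h : `|spin_coef R s (enum_val i) * (y - tnth x i)| <= kappa * `|y - tnth x i|.
  by rewrite normrM norm_spin_coef.
have := ler_wpM2l lambda_ge0 (le_trans (ler_norm _) h).
by rewrite mulrDr; lra.
Qed.

Lemma soft_maxmin_reached a w : reached a w ->
  m%:R^-1 * expR (lambda * a) <= soft_maxmin (joint (enum_family J) w).
Proof.
move=> [v vP]; apply: le_trans (le_bigmax _ _ v).
rewrite /soft_min -[expR _]invrK -invfM lef_pV2 ?posrE ?soft_sum_gt0//; last first.
  by rewrite mulr_gt0 ?invr_gt0 ?expR_gt0// ltr0n.
rewrite -expRN mulr_natl -[X in _ *+ X]card_ord -sumr_const; apply: ler_sum => t _.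
rewrite ler_expR mulNr lerN2 ler_wpM2l//.
apply: (le_trans (vP t)); rewrite /energy !hamiltonianE.
by apply: ler_sum => I _; rewrite joint_enum_familyE.
Qed.

Lemma soft_maxmin_not_reached b w : ~ reached b w ->
  expR (- (lambda * b)) <= (soft_maxmin (joint (enum_family J) w))^-1.
Proof.
move=> nb; rewrite expRN lef_pV2 ?posrE ?expR_gt0 ?soft_maxmin_gt0//.
apply: bigmax_le => // v _.
have [t tb] : exists t, energy (mulS v (u t)) w < b.
  apply: contrapT => /forallNP h; apply: nb; exists v => t.
  by rewrite leNgt; apply/negP.
rewrite /soft_min invf_ple ?posrE ?expR_gt0 ?soft_sum_gt0// -expRN.
rewrite (bigD1 t)//= -[leLHS]addr0 lerD ?sumr_ge0//.
rewrite ler_expR mulNr lerN2 ler_wpM2l//.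
rewrite (_ : hamiltonian _ _ = energy (mulS v (u t)) w); first exact: ltW.
by rewrite /energy !hamiltonianE; apply: eq_bigr => I _; rewrite joint_enum_familyE.
Qed.

(** Markov's inequality is applied to [soft_maxmin] on [reached a] and to its inverse off
    [reached b]; tensorization bounds the product of the two means. *)
Lemma reached_concentration_exp a b :
  (P (reached a) * P (~` reached b) <=
   (m%:R * expR (lambda ^+ 2 / n%:R - lambda * (a - b)))%:E)%E.
Proof.
have nR : 0 < n%:R :> R by rewrite ltr0n.
have mR : 0 < m%:R :> R by rewrite ltr0n.
have kappa0 : 0 <= kappa by exact: powR_ge0.
have := iid_normal_tensorization J_iid (mulr_ge0 lambda_ge0 kappa0)
  measurable_soft_maxmin soft_maxmin_gt0 coord_exp_lip_soft_maxmin.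
(* There are n^p couplings, each with squared constant [lambda ^+ 2] n^(-(p+1)). *)
have -> : (lambda * kappa) ^+ 2 *+ #|{: multi_index n p}| = lambda ^+ 2 / n%:R.
  rewrite exprMn spin_coef_scale// card_ffun !card_ord -mulr_natr natrX.
  by rewrite !exprVn mulrA divfK// expf_neq0// gt_eqF.
set Y := joint _.
have mY : measurable_fun [set: T] (soft_maxmin \o Y).
  exact: measurableT_comp measurable_soft_maxmin (measurable_joint _).
have mYV : measurable_fun [set: T] (fun w => (soft_maxmin (Y w))^-1).
  by apply: measurable_funV_gt0 => // w; exact: soft_maxmin_gt0.
have l0 : 0 <= m%:R^-1 * expR (lambda * a).
  by rewrite mulr_ge0 ?expR_ge0// invr_ge0 ltW.
have h1 := measure_le_integral P l0 (measurable_reached a) mY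
  (fun w => ltW (soft_maxmin_gt0 _)) (@soft_maxmin_reached a).
have sV0 w : 0 <= (soft_maxmin (Y w))^-1.
  by rewrite invr_ge0 ltW// soft_maxmin_gt0.
have h2 := measure_le_integral P (expR_ge0 _)
  (measurableC (measurable_reached b)) mYV sV0
  (@soft_maxmin_not_reached b).
have q1 : (0 <= (m%:R^-1 * expR (lambda * a))%:E * P (reached a))%E.
  by rewrite mule_ge0.
have q2 : (0 <= (expR (- (lambda * b)))%:E * P (~` reached b))%E.
  by rewrite mule_ge0// lee_fin expR_ge0.
move=> h3; have := le_trans (lee_pmul q1 q2 h1 h2) h3.
have fa : P (reached a) \is a fin_num.
  by apply: fin_num_measure; exact: measurable_reached.
have fb : P (~` reached b) \is a fin_num.
  by apply: fin_num_measure; apply: measurableC; exact: measurable_reached.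
rewrite -(fineK fa) -(fineK fb) -!EFinM !lee_fin.
set pa := fine _; set pb := fine _ => h.
rewrite expRD -ler_pdivrMl//.
rewrite -(ler_pM2r (expR_gt0 (lambda * (a - b)))) -[leRHS]mulrA -expRD addNr expR0 mulr1.
apply: le_trans h; rewrite mulrBr expRD.
by rewrite le_eqVlt; apply/orP; left; apply/eqP; ring.
Qed.

End concentration.

Lemma reached_concentration a b : b <= a ->
  (P (reached a) * P (~` reached b) <=
   (m%:R * expR (- (n%:R * (a - b) ^+ 2 / 4)))%:E)%E.
Proof.
move=> ba; have nR : 0 < n%:R :> R by rewrite ltr0n.
(* This [lambda] minimises lambda^2/n - lambda(a - b). *)
have l0 : 0 <= n%:R * (a - b) / 2 by rewrite divr_ge0 ?mulr_ge0 ?subr_ge0.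
apply: le_trans (reached_concentration_exp l0 a b) _.
rewrite lee_fin ler_pM2l ?ltr0n// ler_expR.
rewrite le_eqVlt; apply/orP; left; apply/eqP; field.
by rewrite gt_eqF.
Qed.

End pspin.

(** * Second moment *)

Section second_moment.
Context (R : realType) (n p m : nat) (u : 'I_m -> Sigma n).
Context (d : measure_display) (T : measurableType d) (P : probability T R).
Context (J : multi_index n p -> {RV P >-> R}).
Hypothesis J_iid : iid_standard_normal J.
Hypothesis n_gt0 : (0 < n)%N.
Variables beta eps rho delta : R.
Hypothesis beta_gt0 : 0 < beta.
Hypothesis eps_gt0 : 0 < eps.
Hypothesis rho_ge0 : 0 <= rho.
Hypothesis u_overlap : forall t l, t != l -> 0 <= overlap R (u t) (u l) <= rho.
Hypothesis rho_small : rho ^+ p * (2 * m%:R * (beta + eps)) ^+ 2 <= 2 * delta.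

Let H v t w : R := energy J (mulS v (u t)) w.

Let n_pos : 0 < n%:R :> R. Proof. by rewrite ltr0n. Qed.

Let measurable_H v t : measurable_fun [set: T] (H v t).
Proof. exact: measurable_energy. Qed.

Lemma measurable_expR_energy (K : finType) (b : K -> R) (s : K -> Sigma n) :
  measurable_fun [set: T] (fun w => expR (n%:R * \sum_k b k * energy J (s k) w)).
Proof.
apply: measurableT_comp => //; apply: measurable_funM => //.
apply: measurable_sum => k; apply: measurable_funM => //.
exact: measurable_energy.
Qed.

(** Compared with independent energies, overlaps at most [rho] cost only exp(delta n). This is where
    [rho_small], hence large [p], enters. *)
Lemma energy_mgf_le (K : finType) (b : K -> R) (s : K -> Sigma n) :
  (forall k l, k != l -> `|overlap R (s k) (s l)| <= rho) ->
  \sum_k `|b k| <= 2 * m%:R * (beta + eps) ->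
  (\int[P]_w (expR (n%:R * \sum_k b k * energy J (s k) w))%:E <=
   (expR (n%:R / 2 * (\sum_k b k ^+ 2 + 2 * delta)))%:E)%E.
Proof.
move=> s_rho b_le; rewrite energy_mgf// lee_fin ler_expR.
rewrite ler_pM2l ?divr_gt0//.
apply: (le_trans (@quadratic_form_le _ _ b
  (fun k l => overlap R (s k) (s l) ^+ p) (rho ^+ p) _ _ _)).
- exact: exprn_ge0.
- by move=> k; rewrite overlap_self// expr1n.
- by move=> k l kl; rewrite normrX lerXn2r ?nnegrE// s_rho.
rewrite lerD2l; apply: le_trans rho_small.
rewrite ler_wpM2l ?exprn_ge0// lerXn2r ?nnegrE//.
  by rewrite sumr_ge0.
by rewrite !mulr_ge0// addr_ge0 ?ltW.
Qed.

Let config_overlap v k l : k != l ->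
  `|overlap R (mulS v (u k)) (mulS v (u l))| <= rho.
Proof.
by rewrite overlap_mulS => /u_overlap/andP[ov0 ov]; rewrite ger0_norm.
Qed.

Definition weight v w := expR (n%:R * \sum_t beta * H v t w).

Definition window v : set T :=
  [set w | forall t, beta - eps <= H v t w <= beta + eps].

(** The truncation gives the deterministic cap [tweight_le_cst], which controls pairs with large
    overlap. *)
Definition tweight v w := \1_(window v) w * weight v w.

Lemma measurable_window v : measurable (window v).
Proof.
rewrite (_ : window v = \bigcap_(t in [set: 'I_m])
    (H v t @^-1` `[beta - eps, beta + eps])).
  apply: fin_bigcap_measurable => [|t _]; first exact: finite_finset.
  by rewrite -[X in measurable X]setTI; exact: measurable_H.
apply/seteqP; split => w /= h t; first by move=> _; rewrite /= in_itv/=.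
by have := h t Logic.I; rewrite /= in_itv.
Qed.

Lemma measurable_weight v : measurable_fun [set: T] (weight v).
Proof. exact: (measurable_expR_energy (fun=> beta) (fun t => mulS v (u t))). Qed.

Lemma measurable_tweight v : measurable_fun [set: T] (tweight v).
Proof.
apply: measurable_funM; last exact: measurable_weight.
exact/measurable_indic/measurable_window.
Qed.

Lemma tweight_ge0 v w : 0 <= tweight v w.
Proof. by rewrite mulr_ge0 ?expR_ge0. Qed.

Lemma tweight_le v w : tweight v w <= weight v w.
Proof. by rewrite ler_piMl ?expR_ge0// indicE lern1 leq_b1. Qed.

Lemma tweight_le_cst v w :
  tweight v w <= expR (n%:R * (m%:R * (beta * (beta + eps)))).
Proof.
rewrite /tweight indicE; case: (boolP (w \in _)) => [/set_mem wv|_]; last first.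
  by rewrite mul0r expR_ge0.
rewrite mul1r ler_expR ler_pM2l// mulr_natl -[X in _ *+ X]card_ord -sumr_const.
by apply: ler_sum => t _; rewrite ler_pM2l//; have /andP[] := wv t.
Qed.

(** The overlaps within a tuple are nonnegative, so dropping the off-diagonal covariances only
    lowers the exponent. *)
Lemma weight_integral_ge v :
  ((expR (n%:R / 2 * (m%:R * beta ^+ 2)))%:E <= \int[P]_w (weight v w)%:E)%E.
Proof.
rewrite /weight /H.
rewrite (energy_mgf J_iid n_gt0 (fun=> beta) (fun t => mulS v (u t))).
rewrite lee_fin ler_expR ler_pM2l ?divr_gt0//.
rewrite mulr_natl -[X in _ *+ X]card_ord -sumr_const.
apply: ler_sum => t _; rewrite (bigD1 t)//= overlap_self// expr1n mulr1 -expr2.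
rewrite lerDl sumr_ge0// => l lt; rewrite overlap_mulS.
have /andP[ov0 _] : 0 <= overlap R (u t) (u l) <= rho.
  by apply: u_overlap; rewrite eq_sym.
by apply: mulr_ge0; [apply: mulr_ge0; exact: ltW|exact: exprn_ge0].
Qed.

(** Exponential tilt of energy [t] alone; [c = eps] serves the upper tail and [c = - eps] the lower
    one. *)
Let tilt c (t t' : 'I_m) : R := beta + c * (t' == t)%:R.

Let sum_delta (f : 'I_m -> R) t : \sum_t' (t' == t)%:R * f t' = f t.
Proof.
rewrite (bigD1 t)//= eqxx mul1r big1 ?addr0// => t' /negbTE ->.
by rewrite mul0r.
Qed.

Let sum_tiltM c t (f : 'I_m -> R) :
  \sum_t' tilt c t t' * f t' = \sum_t' beta * f t' + c * f t.
Proof.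
under eq_bigr do rewrite mulrDl -mulrA.
by rewrite big_split/= -[X in _ + X]mulr_sumr sum_delta.
Qed.

Let sum_tilt_sqr c t :
  \sum_t' tilt c t t' ^+ 2 = m%:R * beta ^+ 2 + 2 * beta * c + c ^+ 2.
Proof.
transitivity (\sum_(t' < m) (beta ^+ 2 + (t' == t)%:R * (2 * beta * c + c ^+ 2))).
  by apply: eq_bigr => t' _; rewrite /tilt; case: eqP => _; rewrite /=; ring.
rewrite big_split/= sumr_const card_ord (sum_delta (fun=> 2 * beta * c + c ^+ 2)).
by rewrite -[X in X + _ = _]mulr_natl addrA.
Qed.

Let sum_norm_tilt c t : `|c| <= eps ->
  \sum_t' `|tilt c t t'| <= 2 * m%:R * (beta + eps).
Proof.
move=> ce; apply: (@le_trans _ _ (\sum_(t' < m) (beta + eps))).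
  apply: ler_sum => t' _; apply: (le_trans (ler_normD _ _)).
  rewrite gtr0_norm// lerD2l normrM (le_trans _ ce)// ler_piMr// .
  by case: eqP => _; rewrite ?normr1 ?normr0.
rewrite sumr_const card_ord -[leLHS]mulr_natl; apply: ler_wpM2r.
  by rewrite addr_ge0 ?ltW.
by rewrite ler_peMl// ler1n.
Qed.

Let tilted c v t w := expR (n%:R * \sum_t' tilt c t t' * H v t' w).

Let tilted_integral_le c v t : `|c| <= eps ->
  (\int[P]_w (tilted c v t w)%:E <=
   (expR (n%:R / 2 * (m%:R * beta ^+ 2 + 2 * beta * c + c ^+ 2 + 2 * delta)))%:E)%E.
Proof.
move=> ce; rewrite -(sum_tilt_sqr c t).
apply: (energy_mgf_le (b := tilt c t) (s := fun t' => mulS v (u t'))).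
  exact: config_overlap.
exact: sum_norm_tilt.
Qed.

Let measurable_tilted c v t : measurable_fun [set: T] (tilted c v t).
Proof. exact: (measurable_expR_energy (tilt c t) (fun t' => mulS v (u t'))). Qed.

(** These factors make the tilted weight equal to [weight] when [H v t] sits at the upper,
    respectively lower, edge of the window. *)
Let upper_const : R := expR (- (n%:R * eps * (beta + eps))).
Let lower_const : R := expR (n%:R * eps * (beta - eps)).

(* Outside the window some energy is more than [eps] away from [beta], so that
   tilting it by [eps] in the right direction only increases the weight. *)
Lemma weight_le_tilted v w :
  weight v w <= tweight v w +
    \sum_t (upper_const * tilted eps v t w + lower_const * tilted (- eps) v t w).
Proof.
have tilted0 c t : 0 <= tilted c v t w by exact: expR_ge0.
have uc0 : 0 <= upper_const by exact: expR_ge0.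
have lc0 : 0 <= lower_const by exact: expR_ge0.
rewrite /tweight indicE; case: (boolP (w \in window v)) => [_|].
  rewrite mul1r lerDl sumr_ge0// => t _.
  by rewrite addr_ge0 ?mulr_ge0.
rewrite notin_setE mul0r add0r => nw.
have [t tP] : exists t, ~ (beta - eps <= H v t w <= beta + eps).
  by apply: contrapT => /forallNP h; apply: nw => t; apply: contrapT.
rewrite (bigD1 t)//= -[leLHS]addr0 lerD//; last first.
  by rewrite sumr_ge0// => t' _; rewrite addr_ge0 ?mulr_ge0.
move/negP: tP; rewrite negb_and -!ltNge => /orP[tlt|tgt].
  rewrite -[leLHS]add0r lerD ?mulr_ge0//.
  rewrite /weight /tilted -expRD ler_expR sum_tiltM.
  rewrite -subr_ge0.
  rewrite (_ : _ - _ = n%:R * eps * (beta - eps - H v t w)); last by ring.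
  by rewrite !mulr_ge0 ?subr_ge0// ltW.
rewrite -[leLHS]addr0 lerD ?mulr_ge0//.
rewrite /weight /tilted -expRD ler_expR sum_tiltM.
rewrite -subr_ge0.
rewrite (_ : _ - _ = n%:R * eps * (H v t w - (beta + eps))); last by ring.
by rewrite !mulr_ge0 ?subr_ge0// ltW.
Qed.

Let A0 : R := expR (n%:R / 2 * (m%:R * beta ^+ 2)).

(** Each of the 2m tails has mean at most [A0 * E], and [large_n] says that E <= 1/(4m), so
    truncation removes at most half of [A0]. *)
Lemma tweight_integral_ge v :
  4 * m%:R <= expR (n%:R * (eps ^+ 2 / 2 - delta)) ->
  ((A0 / 2)%:E <= \int[P]_w (tweight v w)%:E)%E.
Proof.
move=> large_n.
pose E := expR (- (n%:R * (eps ^+ 2 / 2 - delta))).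
have uc0 : 0 <= upper_const by exact: expR_ge0.
have lc0 : 0 <= lower_const by exact: expR_ge0.
have tilted0 c t w : 0 <= tilted c v t w by exact: expR_ge0.
have mU t : measurable_fun [set: T]
    (fun w => upper_const * tilted eps v t w + lower_const * tilted (- eps) v t w).
  by apply: measurable_funD; apply: measurable_funM.
have U0 t w : 0 <= upper_const * tilted eps v t w + lower_const * tilted (- eps) v t w.
  by rewrite addr_ge0 ?mulr_ge0.
have tailE t : (\int[P]_w (upper_const * tilted eps v t w +
    lower_const * tilted (- eps) v t w)%:E <= (2 * (A0 * E))%:E)%E.
  rewrite ge0_integralDr; [|exact: measurable_funM|by move=> w; rewrite mulr_ge0
    |exact: measurable_funM|by move=> w; rewrite mulr_ge0].
  rewrite !ge0_integralZlr//.
  have -> : 2 * (A0 * E) = A0 * E + A0 * E by ring.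
  rewrite EFinD; apply: leeD.
    apply: (@le_trans _ _ (upper_const%:E * (expR (n%:R / 2 *
        (m%:R * beta ^+ 2 + 2 * beta * eps + eps ^+ 2 + 2 * delta)))%:E)%E).
      by apply: lee_wpmul2l => //; apply: tilted_integral_le; rewrite gtr0_norm.
    rewrite -EFinM lee_fin /A0 /E -!expRD ler_expR.
    by rewrite le_eqVlt; apply/orP; left; apply/eqP; field.
  apply: (@le_trans _ _ (lower_const%:E * (expR (n%:R / 2 *
      (m%:R * beta ^+ 2 + 2 * beta * (- eps) + (- eps) ^+ 2 + 2 * delta)))%:E)%E).
    by apply: lee_wpmul2l => //; apply: tilted_integral_le; rewrite normrN gtr0_norm.
  rewrite -EFinM lee_fin /A0 /E -!expRD ler_expR.
  by rewrite le_eqVlt; apply/orP; left; apply/eqP; field.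
have AE : A0 * E * (4 * m%:R) <= A0.
  rewrite -mulrA ger_pMr ?expR_gt0// /E expRN mulrC ler_pdivrMr ?expR_gt0//.
  by rewrite mul1r.
have sum_tail : (\int[P]_w (\sum_t (upper_const * tilted eps v t w +
    lower_const * tilted (- eps) v t w))%:E <= (A0 / 2)%:E)%E.
  rewrite ge0_integral_sumr//.
  apply: (@le_trans _ _ (\sum_(t < m) (2 * (A0 * E))%:E)%E).
    by apply: lee_sum => t _; exact: tailE.
  rewrite sumEFin lee_fin sumr_const card_ord -mulr_natl.
  by rewrite ler_pdivlMr//; lra.
have mS : measurable_fun [set: T] (fun w => \sum_t (upper_const * tilted eps v t w +
    lower_const * tilted (- eps) v t w)).
  exact: measurable_sum.
have S0 w : 0 <= \sum_t (upper_const * tilted eps v t w +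
    lower_const * tilted (- eps) v t w).
  by rewrite sumr_ge0.
have := ge0_le_integralr P (fun w => expR_ge0 _) (measurable_weight v)
  (measurable_funD (measurable_tweight v) mS) (weight_le_tilted v).
rewrite ge0_integralDr//; [|exact: measurable_tweight|exact: tweight_ge0].
move=> /(le_trans (weight_integral_ge v)) => h.
have {}h := le_trans h (leeD2l _ sum_tail).
have -> : A0 / 2 = A0 - A0 / 2 by field.
by rewrite EFinB leeBlDr.
Qed.

(** Without truncation, the two tuples form one family of 2m configurations with pairwise overlaps
    at most [rho], so their weights are almost independent. *)
Lemma tweightM_integral_le_far v v' :
  (forall t l, `|overlap R (mulS v (u t)) (mulS v' (u l))| <= rho) ->
  (\int[P]_w (tweight v w * tweight v' w)%:E <= (A0 ^+ 2 * expR (n%:R * delta))%:E)%E.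
Proof.
move=> far.
have dup (x : R) : x *+ (m + m) = 2 * m%:R * x.
  by rewrite mulrnDr -[x *+ m]mulr_natl; ring.
pose s (k : 'I_m + 'I_m) :=
  match k with inl t => mulS v (u t) | inr t => mulS v' (u t) end.
apply: (@le_trans _ _ (\int[P]_w (expR (n%:R *
    \sum_k beta * energy J (s k) w))%:E)%E).
  apply: ge0_le_integralr.
  - by move=> w; rewrite mulr_ge0 ?tweight_ge0.
  - by apply: measurable_funM; exact: measurable_tweight.
  - exact: (measurable_expR_energy (fun=> beta) s).
  - move=> w; rewrite big_sumType/= mulrDr expRD.
    by rewrite ler_pM ?tweight_ge0 ?tweight_le.
apply: (le_trans (energy_mgf_le (b := fun=> beta) (s := s) _ _)).
- move=> [t|t] [l|l] /= tl.
  + by apply: config_overlap; apply: contraNN tl => /eqP ->.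
  + exact: far.
  + by rewrite /overlap /inner; under eq_bigr do rewrite mulrC; exact: far.
  + by apply: config_overlap; apply: contraNN tl => /eqP ->.
- rewrite sumr_const card_sum card_ord gtr0_norm// dup.
  by rewrite ler_wpM2l ?mulr_ge0// lerDl ltW.
rewrite lee_fin /A0 -expRM_natl -expRD ler_expR sumr_const card_sum card_ord dup.
by rewrite le_eqVlt; apply/orP; left; apply/eqP; field.
Qed.

(** For an arbitrary pair, one factor is replaced by its deterministic cap and the other by its
    untruncated mean. *)
Lemma tweightM_integral_le v v' :
  (\int[P]_w (tweight v w * tweight v' w)%:E <=
   (A0 ^+ 2 * expR (n%:R * (m%:R * beta ^+ 2 / 2 + m%:R * beta * eps + delta)))%:E)%E.
Proof.
pose C := expR (n%:R * (m%:R * (beta * (beta + eps)))).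
have C0 : 0 <= C by exact: expR_ge0.
apply: (@le_trans _ _ (\int[P]_w (C * weight v w)%:E)%E).
  apply: ge0_le_integralr.
  - by move=> w; rewrite mulr_ge0 ?tweight_ge0.
  - by apply: measurable_funM; exact: measurable_tweight.
  - by apply: measurable_funM => //; exact: measurable_weight.
  - by move=> w; rewrite mulrC ler_pM ?tweight_ge0 ?tweight_le ?tweight_le_cst.
rewrite ge0_integralZlr//; [|exact: measurable_weight|by move=> w; exact: expR_ge0].
apply: (@le_trans _ _ (C%:E * (expR (n%:R / 2 *
    (\sum_(t < m) beta ^+ 2 + 2 * delta)))%:E)%E).
  apply: lee_wpmul2l => //.
  apply: (energy_mgf_le (b := fun=> beta) (s := fun t => mulS v (u t))).
    exact: config_overlap.
  apply: (@le_trans _ _ (\sum_(t < m) (beta + eps))).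
    by apply: ler_sum => t _; rewrite gtr0_norm// lerDl ltW.
  rewrite sumr_const card_ord -[leLHS]mulr_natl; apply: ler_wpM2r.
    by rewrite addr_ge0 ?ltW.
  by rewrite ler_peMl// ler1n.
rewrite -EFinM lee_fin /A0 /C -expRM_natl -!expRD ler_expR sumr_const card_ord.
by rewrite -[beta ^+ 2 *+ m]mulr_natl le_eqVlt; apply/orP; left; apply/eqP; field.
Qed.

Let near v v' : bool :=
  [exists t, exists l, rho <= `|overlap R (mulS v (u t)) (mulS v' (u l))|].

(** Union bound over the m^2 pairs of indices, each handled by the Chernoff count. *)
Lemma sum_near_le (a theta : R) v : 0 < a ->
  (expR a + expR (- a)) * expR (- (a * rho)) <= expR theta ->
  \sum_v' (near v v')%:R <= 2 * m%:R ^+ 2 * expR (n%:R * theta) :> R.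
Proof.
move=> a0 a_theta.
pose big_ov t l v' := rho <= `|overlap R (mulS v (u t)) (mulS v' (u l))|.
apply: (@le_trans _ _ (\sum_v' \sum_t \sum_l (big_ov t l v')%:R)).
  apply: ler_sum => v' _; case: (boolP (near v v')) => [|_]; last first.
    by rewrite sumr_ge0// => t _; rewrite sumr_ge0.
  move=> /existsP[t /existsP[l tl]].
  rewrite (bigD1 t)//= (bigD1 l)//= /big_ov tl -addrA lerDl.
  by rewrite addr_ge0// sumr_ge0// => i _; rewrite sumr_ge0.
rewrite exchange_big/=.
under eq_bigr do rewrite exchange_big/=.
apply: (@le_trans _ _ (\sum_(t < m) \sum_(l < m) 2 * expR (n%:R * theta))).
  apply: ler_sum => t _; apply: ler_sum => l _.
  apply: (@le_trans _ _ (2 * ((expR a + expR (- a)) * expR (- (a * rho))) ^+ n)).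
    apply: le_trans (card_large_overlap v (u t) (u l) rho a0 n_gt0).
    rewrite -sum1_card natr_sum big_mkcond/= [leRHS]big_mkcond/=.
    by apply: ler_sum => v' _; rewrite inE /big_ov; case: ifP.
  by rewrite ler_pM2l// expRM_natl lerXn2r ?nnegrE ?expR_ge0//.
under eq_bigr do rewrite sumr_const card_ord -mulr_natl.
rewrite sumr_const card_ord -[leLHS]mulr_natl.
by rewrite le_eqVlt; apply/orP; left; apply/eqP; ring.
Qed.

Let card_Sigma : #|{: Sigma n}|%:R = expR (n%:R * ln 2) :> R.
Proof. by rewrite card_ffun card_bool card_ord natrX expRM_natl lnK ?posrE. Qed.

(** Far pairs number at most 4^n, and near ones at most 2^n exp(theta n) up to a constant. The
    condition on [theta] makes this scarcity pay for the larger moment of near pairs. *)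
Lemma square_integral_le (a theta : R) : 0 < a ->
  (expR a + expR (- a)) * expR (- (a * rho)) <= expR theta ->
  theta + m%:R * beta ^+ 2 / 2 + m%:R * beta * eps <= ln 2 ->
  (\int[P]_w ((\sum_v tweight v w) ^+ 2)%:E <=
   ((expR (n%:R * ln 2) * A0) ^+ 2 *
      (expR (n%:R * delta) * (1 + 2 * m%:R ^+ 2)))%:E)%E.
Proof.
move=> a0 a_theta theta_le.
pose q := expR (n%:R * (m%:R * beta ^+ 2 / 2 + m%:R * beta * eps + delta)).
pose pair_bound v v' := A0 ^+ 2 * (expR (n%:R * delta) + (near v v')%:R * q).
have pairE v v' :
    (\int[P]_w (tweight v w * tweight v' w)%:E <= (pair_bound v v')%:E)%E.
  rewrite /pair_bound; case: (boolP (near v v')) => [_|].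
    apply: (le_trans (tweightM_integral_le v v')).
    rewrite lee_fin mul1r ler_wpM2l ?exprn_ge0 ?expR_ge0//.
    by rewrite lerDr expR_ge0.
  move=> /existsPn far; rewrite mul0r addr0; apply: tweightM_integral_le_far.
  by move=> t l; have /existsPn/(_ l) := far t; rewrite -ltNge => /ltW.
have -> : (\int[P]_w ((\sum_v tweight v w) ^+ 2)%:E =
    \int[P]_w (\sum_(vv : Sigma n * Sigma n)
      tweight vv.1 w * tweight vv.2 w)%:E)%E.
  apply: eq_integral => w _; congr EFin.
  by rewrite expr2 big_distrlr/= pair_big.
rewrite ge0_integral_sumr; last 2 first.
- by move=> vv; apply: measurable_funM; exact: measurable_tweight.
- by move=> vv w; rewrite mulr_ge0 ?tweight_ge0.
apply: (@le_trans _ _ (\sum_(vv : Sigma n * Sigma n)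
    (pair_bound vv.1 vv.2)%:E)%E); first by apply: lee_sum => vv _; exact: pairE.
rewrite sumEFin lee_fin -(pair_big xpredT xpredT (fun v v' => pair_bound v v'))/=.
apply: (@le_trans _ _ (\sum_(v : Sigma n) A0 ^+ 2 *
    (expR (n%:R * ln 2) * expR (n%:R * delta) +
     2 * m%:R ^+ 2 * expR (n%:R * theta) * q))).
  apply: ler_sum => v _; rewrite -mulr_sumr ler_wpM2l ?exprn_ge0 ?expR_ge0//.
  rewrite big_split/= lerD//.
    by rewrite sumr_const -[leLHS]mulr_natl card_Sigma.
  by rewrite -mulr_suml ler_wpM2r ?expR_ge0// (sum_near_le v a0 a_theta).
rewrite sumr_const -[leLHS]mulr_natl card_Sigma.
have qle : expR (n%:R * theta) * q <= expR (n%:R * ln 2) * expR (n%:R * delta).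
  rewrite -!expRD ler_expR -!mulrDr ler_pM2l//; lra.
rewrite [leRHS](_ : _ = expR (n%:R * ln 2) * (A0 ^+ 2 *
  (expR (n%:R * ln 2) * expR (n%:R * delta) +
   2 * m%:R ^+ 2 * (expR (n%:R * ln 2) * expR (n%:R * delta))))); last by ring.
rewrite ler_wpM2l ?expR_ge0// ler_wpM2l ?exprn_ge0 ?expR_ge0// lerD2l -mulrA.
by rewrite ler_wpM2l ?mulr_ge0 ?sqr_ge0.
Qed.

(* Paley-Zygmund, through [2 Z <= x Z^2 + 1_{Z > 0} / x] for the best [x]. *)
Lemma reached_ge (a theta : R) : 0 < a ->
  (expR a + expR (- a)) * expR (- (a * rho)) <= expR theta ->
  theta + m%:R * beta ^+ 2 / 2 + m%:R * beta * eps <= ln 2 ->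
  4 * m%:R <= expR (n%:R * (eps ^+ 2 / 2 - delta)) ->
  ((expR (n%:R * delta) * (4 * (1 + 2 * m%:R ^+ 2)))^-1%:E <=
   P (reached u J (beta - eps)))%E.
Proof.
move=> a0 a_theta theta_le large_n.
pose Z w := \sum_v tweight v w.
pose L := expR (n%:R * ln 2) * A0.
pose K := expR (n%:R * delta) * (1 + 2 * m%:R ^+ 2).
have L0 : 0 < L by rewrite mulr_gt0 ?expR_gt0.
have K0 : 0 < K by rewrite mulr_gt0 ?expR_gt0// ltr_wpDr// mulr_ge0 ?sqr_ge0.
(* The mean of [Z] is at least L/2 and its second moment at most L^2 K. This [x] makes the quadratic
   term L/2, half of the lower bound on the mean of 2Z. *)
pose x := (2 * L * K)^-1.
have x0 : 0 < x by rewrite invr_gt0; do 2 apply: mulr_gt0 => //.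
have mZ : measurable_fun [set: T] Z.
  by apply: measurable_sum => v; exact: measurable_tweight.
have Z0 w : 0 <= Z w by rewrite sumr_ge0// => v _; exact: tweight_ge0.
have mA := measurable_reached u J (beta - eps).
set A := reached _ _ _ in mA *.
have m1 : measurable_fun [set: T] (\1_A : T -> R) by exact: measurable_indic.
have mZ2 : measurable_fun [set: T] (fun w => Z w ^+ 2) by exact: measurable_funX.
have pointwise w : 2 * Z w <= x * Z w ^+ 2 + x^-1 * \1_A w.
  rewrite indicE; case: (boolP (w \in A)) => [_|].
    rewrite mulr1 -subr_ge0.
    rewrite (_ : _ - _ = x^-1 * (x * Z w - 1) ^+ 2); last by field; rewrite gt_eqF.
    by rewrite mulr_ge0 ?sqr_ge0// invr_ge0 ltW.
  rewrite notin_setE => nA.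
  rewrite (_ : Z w = 0) ?expr0n/= ?mulr0 ?addr0//.
  apply: big1 => v _; rewrite /tweight indicE.
  case: (boolP (w \in _)) => [/set_mem wv|_]; last by rewrite mul0r.
  by case: nA; exists v => t; have /andP[] := wv t.
have intZ : ((2 * (L / 2))%:E <= \int[P]_w (2 * Z w)%:E)%E.
  rewrite ge0_integralZlr// EFinM; apply: lee_wpmul2l => //.
  rewrite ge0_integral_sumr; [|exact: measurable_tweight|exact: tweight_ge0].
  apply: (@le_trans _ _ (\sum_(v : Sigma n) (A0 / 2)%:E)%E).
    by rewrite sumEFin lee_fin sumr_const -[leRHS]mulr_natl card_Sigma mulrA.
  by apply: lee_sum => v _; exact: tweight_integral_ge.
have x0' := ltW x0.
have xV0 : 0 <= x^-1 by rewrite invr_ge0.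
have mxZ : measurable_fun [set: T] (fun w => x * Z w ^+ 2).
  exact: measurable_funM.
have mx1 : measurable_fun [set: T] (fun w => x^-1 * \1_A w).
  exact: measurable_funM.
have h : ((2 * (L / 2))%:E <= x%:E * (L ^+ 2 * K)%:E + x^-1%:E * P A)%E.
  apply: (le_trans intZ).
  apply: (le_trans (ge0_le_integralr P _ _ (measurable_funD mxZ mx1) pointwise)).
  - by move=> w; rewrite mulr_ge0.
  - exact: measurable_funM.
  rewrite ge0_integralDr//; last 2 first.
  - by move=> w; rewrite mulr_ge0 ?sqr_ge0.
  - by move=> w; rewrite mulr_ge0.
  rewrite !ge0_integralZlr//; last by move=> w; rewrite sqr_ge0.
  rewrite integral_indic// setIT; apply: leeD => //; apply: lee_wpmul2l => //.
  exact: (square_integral_le a0 a_theta theta_le).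
have fA : P A \is a fin_num by exact: fin_num_measure.
move: h; rewrite -(fineK fA) -!EFinM -EFinD !lee_fin.
set pr := fine _ => h.
have xL : x * (L ^+ 2 * K) = L / 2.
  by rewrite /x; field; rewrite !gt_eqF.
have : L / 2 <= x^-1 * pr by move: h; rewrite xL; lra.
have xVgt0 : 0 < x^-1 by rewrite invr_gt0.
rewrite -ler_pdivrMl// invrK /x => h'.
apply: le_trans h'.
by rewrite le_eqVlt; apply/orP; left; apply/eqP; rewrite /K; field; rewrite !gt_eqF ?expR_gt0//;
  rewrite ltr_wpDr// mulr_ge0 ?sqr_ge0.
Qed.

End second_moment.

(** * Choice of the parameters *)

Lemma measurable_S_pspin_nonempty (R : realType) (n p m : nat)
    (gamma xi eta : R) (d : measure_display) (T : measurableType d)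
    (P : probability T R) (J : multi_index n p -> {RV P >-> R}) :
  measurable [set w | @S_pspin R n p (fun I => J I w) gamma m xi eta !=set0].
Proof.
pose level : R := gamma * Num.sqrt (2 * ln 2).
pose overlaps : set (m.-tuple (Sigma n)) :=
  [set s | forall t l : 'I_m, (t < l)%N ->
    xi - eta <= n%:R^-1 * inner R (tnth s t) (tnth s l) <= xi].
rewrite (_ : [set _ | _] = \bigcup_(s in overlaps)
    \bigcap_(t in [set: 'I_m]) [set w | level <= energy J (tnth s t) w]).
  apply: fin_bigcup_measurable; first exact: finite_finset.
  move=> s _; apply: fin_bigcap_measurable; first exact: finite_finset.
  by move=> t _; exact: measurable_energy_ge.
apply/seteqP; split => w /=.
  by move=> [s [s1 s2]]; exists s => // t _; exact: s1.
by move=> [s s2 s1]; exists s; split => // t; exact: s1.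
Qed.

Lemma pow_small (R : realType) (rho c : R) : 0 <= rho -> rho < 1 -> 0 < c ->
  exists N : nat, forall p : nat, (N <= p)%N -> rho ^+ p <= c.
Proof.
move=> rho0 rho1 c0.
have /cvgrPdist_le/(_ _ c0) : (GRing.exp rho : nat -> R) @ \oo --> 0.
  by apply: cvg_expr; rewrite ger0_norm.
move=> [N _ NP]; exists N => p Np.
have := NP p Np; rewrite /= sub0r normrN ger0_norm//; exact: exprn_ge0.
Qed.

Lemma expR_large (R : realType) (C k : R) : 0 < k ->
  exists N : nat, forall n : nat, (N <= n)%N -> C <= expR (n%:R * k).
Proof.
move=> k0; exists (Num.truncn (C / k)).+1 => n Nn.
apply: (le_trans _ (expR_ge1Dx _)).
have : C / k <= n%:R.
  by apply/ltW/(lt_le_trans (truncnS_gt _)); rewrite ler_nat.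
by rewrite ler_pdivrMr//; lra.
Qed.

Theorem theorem2p3 (R : realType) (m : nat) (gamma xi eta : R)
    (m_gt0 : (0 < m)%N)
    (gamma_gt0 : 0 < gamma) (gamma_lt : gamma < 1 / Num.sqrt m%:R)
    (eta_gt0 : 0 < eta) (eta_lt_xi : eta < xi) (xi_lt1 : xi < 1) :
  exists Pstar : nat, forall p : nat, (2 <= p)%N -> (Pstar <= p)%N ->
  exists c : R, 0 < c /\
  exists N : nat, forall n : nat, (N <= n)%N ->
  forall (d : measure_display) (T : measurableType d) (P : probability T R)
    (J : multi_index n p -> {RV P >-> R}),
  iid_standard_normal J ->
  ((1 - expR (- (c * n%:R)))%:E <=
   P [set w | S_pspin (fun I => J I w) gamma m xi eta !=set0])%E.
Proof.
have xi_gt0 : 0 < xi by exact: lt_trans eta_lt_xi.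
have mR : 0 < m%:R :> R by rewrite ltr0n.
have sm : 0 < Num.sqrt m%:R :> R by rewrite sqrtr_gt0.
have ln2 : 0 < ln 2 :> R by rewrite ln_gt0// ltr1n.
pose h : R := Num.sqrt (2 * ln 2).
have h0 : 0 < h by rewrite sqrtr_gt0 mulr_gt0.
have hh : h ^+ 2 = 2 * ln 2 by rewrite sqr_sqrtr// mulr_ge0// ltW.
(* The midpoint between the target level and the threshold at which m beta^2 = 2 ln 2. *)
pose beta := (gamma * h + h / Num.sqrt m%:R) / 2.
have gh_lt : gamma * h < h / Num.sqrt m%:R.
  by rewrite mulrC ltr_pM2l// -div1r.
have beta_gt : gamma * h < beta by rewrite /beta; lra.
have beta_lt : beta < h / Num.sqrt m%:R by rewrite /beta; lra.
have gh0 : 0 < gamma * h by rewrite mulr_gt0.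
have beta0 : 0 < beta by exact: lt_trans beta_gt.
have mbeta : m%:R * beta ^+ 2 < 2 * ln 2.
  have : beta ^+ 2 < (h / Num.sqrt m%:R) ^+ 2.
    by rewrite ltr_pXn2r ?nnegrE ?ltW// divr_gt0.
  rewrite [ltRHS]expr_div_n hh (@sqr_sqrtr _ m%:R) ?ler0n//.
  by rewrite ltr_pdivlMr// mulrC.
(* The entropy left over: half pays for the number of near pairs, half for the width of the
   window. *)
pose theta := ln 2 - m%:R * beta ^+ 2 / 2.
have theta0 : 0 < theta by rewrite /theta; lra.
(* The first bound leaves a gap of at least [eps] between [beta - eps] and the target level; the
   second keeps m beta eps within theta/2. *)
pose eps := Num.min ((beta - gamma * h) / 2) (theta / (2 * (m%:R * beta))).
have eps0 : 0 < eps.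
  rewrite lt_min; apply/andP; split; apply: divr_gt0 => //.
    by rewrite subr_gt0.
  by apply: mulr_gt0 => //; exact: mulr_gt0.
have eps1 : eps <= (beta - gamma * h) / 2 by rewrite ge_min lexx.
have eps2 : m%:R * beta * eps <= theta / 2.
  have : eps <= theta / (2 * (m%:R * beta)) by rewrite ge_min lexx orbT.
  have mb : 0 < m%:R * beta by rewrite mulr_gt0.
  move=> /(ler_wpM2l (ltW mb)) /le_trans; apply.
  by rewrite le_eqVlt; apply/orP; left; apply/eqP; field; rewrite !gt_eqF.
have t2 : 0 < theta / 2 by rewrite divr_gt0.
have [a [rho [a0 xi_rho rho1 a_theta]]] := chernoff_parameters t2 xi_lt1.
have rho0 : 0 <= rho by apply: le_trans xi_rho; exact: ltW.
(* Exponent budget: concentration gains eps^2/4, the second moment loses [delta], and absorbing the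
   constant [C] loses eps^2/8. The remaining eps^2/16 is the final rate. *)
pose delta := eps ^+ 2 / 16.
have delta0 : 0 < delta by rewrite divr_gt0// exprn_gt0.
pose B := (2 * m%:R * (beta + eps)) ^+ 2.
have B0 : 0 < B 
  by apply: exprn_gt0; apply: mulr_gt0; [exact: mulr_gt0|exact: addr_gt0].
have cB : 0 < 2 * delta / B by rewrite divr_gt0// mulr_gt0.
have [Pstar PstarP] := pow_small rho0 rho1 cB.
exists Pstar => p _ Pp; exists (eps ^+ 2 / 16); split => //.
have rho_small : rho ^+ p * B <= 2 * delta.
  by rewrite -ler_pdivlMr//; exact: PstarP.
(* Collects the factor [m] from concentration and 4(1 + 2m^2) from Paley-Zygmund; it also dominates
   the 4m in [large_n]. *)
pose C := 4 * m%:R * (1 + 2 * m%:R ^+ 2) : R.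
have k0 : 0 < eps ^+ 2 / 8 by rewrite divr_gt0// exprn_gt0.
have [N1 N1P] := expR_large C k0.
have [N2 N2P] := equal_overlap_family m eta_gt0 eta_lt_xi xi_lt1.
exists (maxn 1 (maxn N1 N2)) => n; rewrite !geq_max => /and3P[n0 nN1 nN2].
move=> d T P J J_iid.
have nR : 0 < n%:R :> R by rewrite ltr0n.
have [u uP] := N2P n nN2.
have u_overlap t l : t != l -> 0 <= overlap R (u t) (u l) <= rho.
  by move=> /uP[-> /andP[_ ov]]; exact: le_trans xi_rho.
have Cn := N1P n nN1.
have large_n : 4 * m%:R <= expR (n%:R * (eps ^+ 2 / 2 - delta)).
  apply: (le_trans (_ : _ <= C)).
    by rewrite /C ler_peMr ?mulr_ge0// lerDl mulr_ge0 ?sqr_ge0.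
  apply: (le_trans Cn); rewrite ler_expR ler_pM2l// /delta.
  by have := sqr_ge0 eps; lra.
have theta_le : theta / 2 + m%:R * beta ^+ 2 / 2 + m%:R * beta * eps <= ln 2.
  by move: eps2; rewrite /theta; lra.
have lower := reached_ge J_iid n0 beta0 eps0 rho0 u_overlap rho_small
  a0 a_theta theta_le large_n.
have ba : gamma * h <= beta - eps by lra.
have conc := reached_concentration u J_iid n0 m_gt0 ba.
have mbad : measurable (~` reached u J (gamma * h)).
  by apply: measurableC; exact: measurable_reached.
have fbad : P (~` reached u J (gamma * h)) \is a fin_num.
  exact: fin_num_measure.
have fgood : P (reached u J (beta - eps)) \is a fin_num.
  by apply: fin_num_measure; exact: measurable_reached.
(* Dividing the concentration bound by the lower bound on the probability of reaching [beta - eps]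
   makes failure at the lower level exponentially unlikely. *)
have bad_le : (P (~` reached u J (gamma * h)) <=
    (expR (- (eps ^+ 2 / 16 * n%:R)))%:E)%E.
  move: lower conc; rewrite -(fineK fbad) -(fineK fgood) -EFinM !lee_fin.
  set pg := fine _; set pb := fine _ => lower conc.
  have pb0 : 0 <= pb by exact: fine_ge0.
  pose D := expR (n%:R * delta) * (4 * (1 + 2 * m%:R ^+ 2)) : R.
  have D0 : 0 < D.
    by rewrite !mulr_gt0 ?expR_gt0// ltr_wpDr// mulr_ge0 ?sqr_ge0.
  have pbD : pb <= D * (m%:R * expR (- (n%:R * (beta - eps - gamma * h) ^+ 2 / 4))).
    rewrite -ler_pdivrMl//; apply: le_trans conc.
    by rewrite ler_wpM2r.
  apply: (le_trans pbD).
  have eps_gap : eps ^+ 2 <= (beta - eps - gamma * h) ^+ 2.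
    by rewrite lerXn2r ?nnegrE ?subr_ge0//; lra.
  apply: (@le_trans _ _ (C * (expR (n%:R * delta) *
      expR (- (n%:R * (eps ^+ 2 / 4)))))).
    set Y := expR (- (n%:R * (eps ^+ 2 / 4))).
    have -> : C * (expR (n%:R * delta) * Y) = D * (m%:R * Y).
      by rewrite /C /D; ring.
    rewrite ler_pM2l// ler_pM2l// ler_expR lerN2 -mulrA ler_pM2l//.
    by rewrite ler_pM2r// invr_gt0.
  apply: (@le_trans _ _ (expR (n%:R * (eps ^+ 2 / 8)) * (expR (n%:R * delta) *
      expR (- (n%:R * (eps ^+ 2 / 4)))))).
    by rewrite ler_pM2r ?mulr_gt0 ?expR_gt0.
  rewrite -!expRD ler_expR /delta.
  by rewrite le_eqVlt; apply/orP; left; apply/eqP; field.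
apply: (@le_trans _ _ (P (reached u J (gamma * h)))).
  have := probability_setC P (measurable_reached u J (gamma * h)).
  move: bad_le; rewrite -(fineK fbad).
  have fr : P (reached u J (gamma * h)) \is a fin_num.
    by apply: fin_num_measure; exact: measurable_reached.
  rewrite -(fineK fr) -EFinB !lee_fin => bad_le [] E.
  by move: bad_le; rewrite E; lra.
apply: le_measure; rewrite ?inE.
- exact: measurable_reached.
- exact: measurable_S_pspin_nonempty.
(* The tuple of the [mulS v (u t)] inherits the overlaps of [u], so only the energies depend on
   [v]. *)
move=> w [v vP]; exists [tuple mulS v (u t) | t < m]; split.
  by move=> t; rewrite tnth_mktuple; exact: vP.
move=> t l tl; rewrite !tnth_mktuple -/(overlap R _ _) overlap_mulS.
by have [|_] := uP t l; first by rewrite neq_ltn tl.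
Qed.
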